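(* Let $(X,d,\mathfrak m)$ be a metric measure space and let $\Omega\subset X$ be an open subset. Then $\Omega$ is a $BV$-extension set if and only if $\Omega$ has the extension property for sets of finite perimeter with the full norm.
   Context: Standing assumption: a metric measure space $(X,d,\mathfrak m)$ consists of a complete separable metric space $(X,d)$ and a nonnegative Borel measure $\mathfrak m$ on $X$ that is finite on bounded sets. No doubling or Poincaré assumption is made. Slope: $\mathrm{lip} f(x)=\limsup_{y\to x}\frac{|f(y)-f(x)|}{d(x,y)}$, with $\mathrm{lip} f(x)=0$ if $x$ is isolated. $\mathrm{Lip}_{\rm loc}(A)$ denotes the locally Lipschitz functions on the open set $A$. Local integrability: $L^1_{\rm loc}(\mathfrak m)$ is the set of measurable functions $f$ such that every $x\in X$ has an open neighbourhood $U$ with $f\in L^1(\mathfrak m|_U)$; convergence in $L^1_{\rm loc}(\mathfrak m)$ means that every $x\in X$ has an open neighbourhood $U$ with convergence in $L^1(\mathfrak m|_U)$. For Borel $B\subset X$, $L^1_{\rm loc}(\mathfrak m|_B)$ is defined in the same way using the measure $\mathfrak m|_B$ on $X$. Total variation: for $f\in L^1_{\rm loc}(\mathfrak m)$ and $A\subset X$ open, $$|Df|(A)=\inf\Big\{\liminf_{n}\int_A \mathrm{lip} f_n\,d\mathfrak m:\ f_n\in \mathrm{Lip}_{\rm loc}(A),\ f_n\to f\text{ in }L^1_{\rm loc}(\mathfrak m|_A)\Big\},$$ and for Borel $B\subset X$, $|Df|(B)=\inf\{|Df|(A): B\subset A,\ A\text{ open}\}$. For Borel $B\subset X$ and $u\in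 L^1_{\rm loc}(\mathfrak m|_B)$, $|Du|_B$ denotes the total variation of $u$ computed in the metric measure space $(X,d,\mathfrak m|_B)$. Space $BV$: for Borel $B\subset X$, $BV(B)=\{u\in L^1(\mathfrak m|_B): |Du|_B(B)<\infty\}$ with norm $\|u\|_{BV(B)}=\|u\|_{L^1(\mathfrak m|_B)}+|Du|_B(B)$. $BV$-extension set: there exist $C>0$ and a (not necessarily linear) map $E\colon BV(\Omega)\to BV(X)$ such that for every $u\in BV(\Omega)$: $\|Eu\|_{BV(X)}\le C\|u\|_{BV(\Omega)}$ and $Eu|_\Omega=u$ ($\mathfrak m$-a.e.). Perimeter: for Borel $E\subset X$ and Borel $B$, $P(E,B)=|D\chi_E|(B)$. A Borel set $E\subset\Omega$ has finite perimeter on $\Omega$ if $P_\Omega(E):=|D\chi_E|_\Omega(\Omega)<\infty$. Extension property for sets of finite perimeter with the full norm: there exists $C>0$ such that for every Borel $E\subset\Omega$ of finite perimeter on $\Omega$ there is a Borel set $\tilde E\subset X$ with $\mathfrak m(\tilde E)+P(\tilde E,X)\le C(\mathfrak m(E)+P_\Omega(E))$ and $\mathfrak m(E\,\Delta\,(\tilde E\cap\Omega))=0$. *)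

(* Defs.v *)
From HB Require Import structures.
From mathcomp Require Import all_boot all_order all_algebra.
From mathcomp Require Import all_classical all_reals all_analysis.
From mathcomp Require Import measurable_realfun.

Set Implicit Arguments.
Unset Strict Implicit.
Unset Printing Implicit Defensive.

Import Order.TTheory GRing.Theory Num.Theory.
Import numFieldNormedType.Exports.

Local Open Scope classical_set_scope.
Local Open Scope ring_scope.

#[short(type="completeMetricType")]
HB.structure Definition CompleteMetric (R : numDomainType) :=
  { T of Metric R T & Complete T }.

Definition separable (T : topologicalType) :=
  exists2 S : set T, countable S & dense S.

Definition borel (T : ptopologicalType) := g_sigma_algebraType (@open T).

Section metric_measure_space.
Context {R : realType} {X : completeMetricType R}.

Lemma open_borel (A : set X) : open A -> measurable (A : set (borel X)).
Proof. exact: sub_sigma_algebra. Qed.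

Definition finite_on_bounded (m : {measure set (borel X) -> \bar R}) :=
  forall B : set (borel X), measurable B ->
    (exists (x : X) (r : R), B `<=` ball x r) -> (m B < +oo)%E.

Definition slope (f : X -> R) (x : X) : \bar R :=
  if `[< isolated [set: X] x >] then 0%E
  else limf_esup (fun y => (`|f y - f x| / mdist x y)%:E) x^'.

Definition locally_lipschitz_on (A : set X) (f : X -> R) :=
  forall x, A x -> exists2 U : set X, nbhs x U & exists L : R,
    forall y z, (U `&` A) y -> (U `&` A) z -> `|f y - f z| <= L * mdist y z.

(* Convergence in L^1_loc(m|_A).  The points x range over all of X, not only
   over A, and L^1((m|_A)|_U) is L^1 of m over U `&` A. *)
Definition L1loc_cvg (m : {measure set (borel X) -> \bar R}) (A : set X)
    (f_ : (X -> R)^nat) (f : X -> R) :=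
  forall x : X, exists U : set X, [/\ open U, U x,
    forall n, m.-integrable (U `&` A) (EFin \o f_ n),
    m.-integrable (U `&` A) (EFin \o f) &
    (\int[m]_(y in U `&` A) `|f_ n y - f y|%:E)%E @[n --> \oo] --> 0%E].

(* Functions on A are represented by their extensions to X: [slope] on the open
   set A and [L1loc_cvg] on A do not depend on the values outside A. *)
Definition total_variation_open (m : {measure set (borel X) -> \bar R})
    (f : X -> R) (A : set X) : \bar R :=
  ereal_inf
    [set limn_einf (fun n => \int[m]_(x in A) slope (f_ n) x)%E | f_ in
      [set f_ : (X -> R)^nat |
        (forall n, locally_lipschitz_on A (f_ n)) /\ L1loc_cvg m A f_ f]].

(* |Df|(B) for Borel B; it coincides with [total_variation_open] when B is
   open, see [total_variation_openE]. *)
Definition total_variation (m : {measure set (borel X) -> \bar R})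
    (f : X -> R) (B : set X) : \bar R :=
  ereal_inf [set total_variation_open m f A | A in
    [set A : set X | open A /\ B `<=` A]].

Lemma slope_ge0 (f : X -> R) (x : X) : (0 <= slope f x)%E.
Proof.
rewrite /slope; case: asboolP => // xiso.
apply: limf_esup_ge0 => [x0|y]; last by rewrite lee_fin divr_ge0 ?mdist_ge0.
apply: xiso; split; first by rewrite inE.
exists [set x]; last by rewrite setIT.
move: x0; rewrite /dnbhs /within/=; apply: filterS => y /=.
by case: (eqVneq y x) => // _ /(_ isT).
Qed.

Lemma le_total_variation_open (m : {measure set (borel X) -> \bar R})
    (f : X -> R) (A B : set X) : open A -> open B -> A `<=` B ->
  (total_variation_open m f A <= total_variation_open m f B)%E.
Proof.
move=> oA oB AB; apply: le_ereal_inf_tmp => _ [f_ [lipf cvgf] <-].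
apply: (@le_trans _ _ (limn_einf (fun n => \int[m]_(x in A) slope (f_ n) x)%E)).
  apply: ereal_inf_lbound; exists f_ => //; split.
    move=> n x /AB /(lipf n)[U xU [L UL]]; exists U => //; exists L => y z.
    by move=> [Uy /AB By] [Uz /AB Bz]; exact: UL.
  move=> x; have [U [oU Ux f_int f_lim fnf]] := cvgf x.
  have mUA : measurable (U `&` A : set (borel X)).
    by apply: open_borel; exact: openI.
  have mUB : measurable (U `&` B : set (borel X)).
    by apply: open_borel; exact: openI.
  have UAB : U `&` A `<=` U `&` B by exact: setIS.
  exists U; split => //; [by move=> n; exact: integrableS (f_int n)|
    exact: integrableS f_lim|].
  apply: (squeeze_cvge _ (cvg_cst 0%E) fnf); apply: nearW => n.
  apply/andP; split; first by apply: integral_ge0 => *; rewrite lee_fin.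
  have /measurable_EFinP mfn := measurable_int _ (f_int n).
  have /measurable_EFinP mf := measurable_int _ f_lim.
  apply: ge0_subset_integral => //.
  by apply/measurable_EFinP/measurableT_comp => //; exact: measurable_funB.
rewrite !limn_einf_lim; apply: lee_lim; [exact: is_cvg_einfs|exact: is_cvg_einfs|].
apply: nearW => n; apply: le_ereal_inf_tmp => _ [k nk <-].
apply: ge_ereal_inf; exists (\int[m]_(x in A) slope (f_ k) x)%E; first by exists k.
rewrite !ge0_integralE; [|by move=> *; exact: slope_ge0..].
apply: ereal_sup_le => _ [h hA <-].
exists h => // x; apply: (le_trans (hA x)).
rewrite !patchE; case: ifPn => [/set_mem/AB/mem_set -> //|_].
by case: ifPn => // _; exact: slope_ge0.
Qed.

Lemma total_variation_openE (m : {measure set (borel X) -> \bar R})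
    (f : X -> R) (A : set X) : open A ->
  total_variation m f A = total_variation_open m f A.
Proof.
move=> oA; apply/eqP; rewrite eq_le; apply/andP; split.
  by apply: ereal_inf_lbound; exists A => //; split.
apply: le_ereal_inf_tmp => _ [B [oB AB] <-].
exact: le_total_variation_open.
Qed.

Section BV.
Context (m : {measure set (borel X) -> \bar R}).
Context (B : set X) (mB : measurable (B : set (borel X))).

Definition total_variation_in (u : X -> R) (A : set X) : \bar R :=
  total_variation (mrestr m mB) u A.

(* Elements of BV(B) are represented by Borel functions on X; two of them are
   the same element when they are equal m-a.e. in B. *)
Definition BV : set (X -> R) :=
  [set u | (mrestr m mB).-integrable [set: X] (EFin \o u) /\
           (total_variation_in u B < +oo)%E].

Definition BVnorm (u : X -> R) : \bar R :=
  (Lnorm (mrestr m mB) 1 (EFin \o u) + total_variation_in u B)%E.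

End BV.

Section extension.
Context (m : {measure set (borel X) -> \bar R}).
Context (Omega : set X) (mOmega : measurable (Omega : set (borel X))).

Let mX : measurable ([set: X] : set (borel X)) := measurableT.

(* The second clause says that E is well defined on a.e. classes. *)
Definition BV_extension_set :=
  exists (C : R) (E : (X -> R) -> (X -> R)), [/\ 0 < C,
    forall u v, BV m mOmega u -> BV m mOmega v ->
      u = v %[ae m in Omega] -> E u = E v %[ae m] &
    forall u, BV m mOmega u ->
      [/\ BV m mX (E u),
          (BVnorm m mX (E u) <= C%:E * BVnorm m mOmega u)%E &
          E u = u %[ae m in Omega]]].

Definition perimeter (E B : set X) : \bar R := total_variation m \1_E B.

Definition perimeter_in (E : set X) : \bar R :=
  total_variation_in m mOmega \1_E Omega.

Definition perimeter_extension_property :=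
  exists2 C : R, 0 < C & forall E : set (borel X),
    measurable E -> E `<=` Omega -> (perimeter_in E < +oo)%E ->
    exists F : set (borel X), [/\ measurable F,
      (m F + perimeter F [set: X] <= C%:E * (m E + perimeter_in E))%E &
      m (E `+` (F `&` Omega)) = 0%E].

End extension.

End metric_measure_space.

(* Main.v *)
Require Import Defs.
From HB Require Import structures.
From mathcomp Require Import all_boot all_order all_algebra.
From mathcomp Require Import all_classical all_reals all_analysis.
From mathcomp Require Import measurable_realfun.
From mathcomp Require Import lra.

(** Both implications rest on one selection principle, [coarea_level]: a
    function of finite norm has, among its levels in an interval of length [h],
    a superlevel set whose measure plus perimeter is at most the norm divided
    by [h], up to an arbitrarily small loss.  It comes from averaging over the
    level: if [f_n] are locally Lipschitz approximations of [u], then the ramps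
    of [f_n] at the level [t] converge to the indicator of the set where
    [t < u], and by Tonelli the average over [t] of the integrals of their
    slopes is controlled by the integral of the slope of [f_n].

    If functions extend, so do sets: extend the indicator of the set and take
    a superlevel set of the extension at a level in (0, 1).

    Conversely, let sets extend and let [u] be in BV(Omega).  Positive and
    negative parts reduce the problem to [0 <= u].  Cutting [u] at the integers
    into layers with values in [0, 1] costs a factor 2 in the total variation
    ([sum_total_variation_layer]), and the extensions of the layers can be
    summed ([nonneg_extension]); so let [0 <= u <= 1].  For every [n], cut [u]
    further into layers of height 1 / n, select one good level in each layer,
    extend the corresponding superlevel set and add up the indicators of the
    extended sets with weight 1 / n ([quantized_extension]).  The result is
    within 1 / n of [u] in Omega and its norm is bounded independently of [n].

    A limit is still needed, and without doubling and Poincare assumptions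
    there is no compactness in BV.  However the functions with values in [0, 1]
    and bounded norm that are within 1 / n of [u] in Omega form a decreasing
    sequence of convex sets, bounded in L^2 because w ^ 2 <= w.  Elements of
    almost minimal L^2 norm form a Cauchy sequence by the parallelogram law
    ([convex_selection]); their limit is the extension ([bounded_extension]).

    The last point is the lower semicontinuity of the total variation.  In its
    definition the neighbourhoods of L^1_loc convergence depend on the
    approximating sequence, which obstructs diagonal arguments.  The proof
    works instead with [approximable] functions, for which approximation takes
    place on arbitrarily large balls around one point.  This class is closed
    under linear combinations and limits, it bounds the total variation, and it
    contains the indicators of sets of finite perimeter: truncation to [0, 1]
    and the Lindelof property turn local convergence into convergence on
    balls ([approximable_indic]). *)

Set Implicit Arguments.
Unset Strict Implicit.
Unset Printing Implicit Defensive.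

Import Order.TTheory GRing.Theory Num.Theory.
Import numFieldNormedType.Exports.

Local Open Scope classical_set_scope.
Local Open Scope ring_scope.

(** * Slopes of locally Lipschitz functions *)

Section slope_theory.
Context {R : realType} {X : completeMetricType R}.
Implicit Types (f g : X -> R) (x y : X) (A : set X) (a L : R).

Lemma exists_invn_lt (e : R) : 0 < e -> exists n, n.+1%:R^-1 < e.
Proof.
move=> e0; have [n _ /(_ n (leqnn n)) /= ne] :=
  near_infty_natSinv_lt (PosNum e0).
by exists n.
Qed.

Lemma ball_mdist x r y : ball x r y = (mdist x y < r) :> Prop.
Proof. by rewrite ballEmdist. Qed.

(** This trades the limit superior over punctured neighbourhoods for a metric
    inequality; all estimates of slopes go through it.  At an isolated point
    the right-hand side holds on a ball reduced to its centre. *)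
Lemma slope_leP f x a : 0 <= a -> (slope f x <= a%:E)%E <->
  forall e, 0 < e -> exists2 r, 0 < r &
    forall y, mdist x y < r -> `|f y - f x| <= (a + e) * mdist x y.
Proof.
move=> a0; rewrite /slope; case: asboolP => [xiso|xiso].
  split => [_ e e0|_]; last by rewrite lee_fin.
  have [_ [V xV Vx]] := xiso.
  have /nbhs_ballP[r /= r0 rV] := xV.
  exists r => // y; rewrite -ball_mdist => /rV Vy.
  have : (V `&` [set: X]) y by [].
  by rewrite Vx => ->; rewrite subrr normr0 mdistxx mulr0.
split => [xa e e0|H].
  have : (ereal_inf [set ereal_sup [set (`|f y - f x| / mdist x y)%:E | y in V]
      | V in x^'] < (a + e)%:E)%E.
    by apply: (le_lt_trans xa); rewrite lte_fin ltrDl.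
  move=> /ereal_inf_lt[_ [V xV <-] Ve].
  have /nbhs_ballP[r /= r0 rV] := xV.
  exists r => // y xy.
  have [->|yx] := eqVneq y x; first by rewrite subrr normr0 mdistxx mulr0.
  have Vy : V y by apply: rV => //; rewrite ball_mdist.
  have d0 : 0 < mdist x y by rewrite mdist_gt0 eq_sym.
  rewrite -ler_pdivrMr// -lee_fin; apply: le_trans (ltW Ve).
  by apply: ereal_sup_ubound; exists y.
apply/lee_addgt0Pr => e e0; have [r r0 rf] := H e e0.
apply: ge_ereal_inf.
exists (ereal_sup [set (`|f y - f x| / mdist x y)%:E | y in
  [set y | mdist x y < r /\ y != x]]).
  eexists; last by [].
  rewrite /dnbhs /within/=; apply/nbhs_ballP; exists r => //= y.
  by rewrite ball_mdist.
apply: ub_ereal_sup => _ [y [xy yx] <-].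
have d0 : 0 < mdist x y by rewrite mdist_gt0 eq_sym.
by rewrite -EFinD lee_fin ler_pdivrMr// rf.
Qed.

Lemma slope_add f g x : (slope (fun y => f y + g y)%R x <= slope f x + slope g x)%E.
Proof.
have := slope_ge0 f x; have := slope_ge0 g x.
case Ef : (slope f x) => [a| |] //; case Eg : (slope g x) => [b| |] //;
  rewrite ?leey// !lee_fin => b0 a0.
have /slope_leP-/(_ a0) Hf : (slope f x <= a%:E)%E by rewrite Ef.
have /slope_leP-/(_ b0) Hg : (slope g x <= b%:E)%E by rewrite Eg.
rewrite -EFinD; apply/slope_leP => [|e e0]; first exact: addr_ge0.
have e20 : 0 < e / 2 by rewrite divr_gt0.
have [r r0 rf] := Hf _ e20; have [s s0 sg] := Hg _ e20.
exists (Num.min r s); first by rewrite lt_min r0.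
move=> y; rewrite lt_min => /andP[/rf Hr /sg Hs] /=.
rewrite opprD addrACA; apply: (le_trans (ler_normD _ _)).
by apply: (le_trans (lerD Hr Hs)); lra.
Qed.

Lemma slope_comp (phi : R -> R) L f x : 0 <= L ->
  (forall s t, `|phi s - phi t| <= L * `|s - t|) ->
  (slope (phi \o f) x <= L%:E * slope f x)%E.
Proof.
move=> L0 phiL; have := slope_ge0 f x.
case Ef : (slope f x) => [a| |] //; rewrite ?lee_fin => a0.
  have /slope_leP-/(_ a0) Hf : (slope f x <= a%:E)%E by rewrite Ef.
  rewrite -EFinM; apply/slope_leP => [|e e0]; first exact: mulr_ge0.
  have L10 : 0 < L + 1 by rewrite ltr_wpDl.
  have [r r0 rf] := Hf _ (divr_gt0 e0 L10).
  exists r => // y /rf H.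
  apply: (le_trans (phiL _ _)); apply: (le_trans (ler_wpM2l L0 H)).
  rewrite mulrA ler_wpM2r ?mdist_ge0// mulrDr lerD2l mulrCA.
  by rewrite ler_piMr ?(ltW e0)// ler_pdivrMr// mul1r lerDl.
have [L_0|Lneq0] := eqVneq L 0; last first.
  by rewrite gt0_muley ?leey// lte_fin lt_neqAle eq_sym Lneq0.
rewrite L_0 in phiL *; rewrite mul0e; apply/slope_leP => // e e0; exists 1 => // y _ /=.
apply: (le_trans (phiL _ _)).
by rewrite mul0r add0r mulr_ge0 ?mdist_ge0 ?(ltW e0).
Qed.

Lemma slope_locally_constant f x r : 0 < r ->
  (forall y, mdist x y < r -> f y = f x) -> slope f x = 0%E.
Proof.
move=> r0 fx; apply/eqP; rewrite eq_le slope_ge0 andbT.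
apply/slope_leP => // e e0; exists r => // y /fx ->.
by rewrite subrr normr0 mulr_ge0 ?mdist_ge0// add0r ltW.
Qed.

Lemma loc_lip_ball A f x : open A -> locally_lipschitz_on A f -> A x ->
  exists r L, [/\ 0 < r, 0 <= L, (forall y, mdist x y < r -> A y) &
    forall y z, mdist x y < r -> mdist x z < r ->
      `|f y - f z| <= L * mdist y z].
Proof.
move=> oA lipf Ax; have [U xU [L UL]] := lipf x Ax.
have : nbhs x (U `&` A) by apply: filterI => //; exact: open_nbhs_nbhs.
move=> /nbhs_ballP[r /= r0 rUA]; exists r, `|L|; split => //.
  by move=> y; rewrite -ball_mdist => /rUA[].
move=> y z; rewrite -!ball_mdist => /rUA Uy /rUA Uz.
by apply: (le_trans (UL _ _ Uy Uz)); rewrite ler_wpM2r ?mdist_ge0// ler_norm.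
Qed.

Lemma locally_lipschitz_comp (phi : R -> R) L f A : 0 <= L ->
  (forall s t, `|phi s - phi t| <= L * `|s - t|) ->
  locally_lipschitz_on A f -> locally_lipschitz_on A (phi \o f).
Proof.
move=> L0 phiL lipf x /lipf[U xU [M UM]]; exists U => //; exists (L * M) => y z.
move=> Uy Uz; apply: (le_trans (phiL _ _)); rewrite -mulrA ler_wpM2l//.
exact: UM.
Qed.

Lemma locally_lipschitz_add f g A : locally_lipschitz_on A f ->
  locally_lipschitz_on A g -> locally_lipschitz_on A (fun x => f x + g x).
Proof.
move=> lipf lipg x Ax; have [U xU [L UL]] := lipf _ Ax.
have [V xV [M VM]] := lipg _ Ax.
exists (U `&` V); first exact: filterI.
exists (L + M) => y z [[Uy Vy] Ay] [[Uz Vz] Az].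
rewrite opprD addrACA mulrDl; apply: (le_trans (ler_normD _ _)).
by apply: lerD; [exact: UL|exact: VM].
Qed.

Lemma measurable_loc_lip A f : open A -> locally_lipschitz_on A f ->
  measurable_fun (A : set (borel X)) f.
Proof.
move=> oA lipf; move=> mA.
apply: (measurability _ (RGenOInfty.measurableE R)) => //.
move=> /= _ [_ [a ->] <-]; apply: open_borel; rewrite openE => x [Ax].
rewrite /= in_itv/= andbT => afx.
have [r [L [r0 L0 rA rL]]] := loc_lip_ball oA lipf Ax.
have L1 : 0 < L + 1 by rewrite ltr_wpDl.
apply/nbhs_ballP; exists (Num.min r ((f x - a) / (L + 1))).
  by rewrite /= lt_min r0 divr_gt0 ?subr_gt0.
move=> y; rewrite ball_mdist lt_min => /andP[xyr].
rewrite ltr_pdivlMr// => xya; split; first exact: rA.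
rewrite /= in_itv/= andbT; have := rL x y; rewrite mdistxx => /(_ r0 xyr).
have := mdist_ge0 x y; rewrite ler_norml => d0 /andP[_]; nra.
Qed.

(** Once the tolerance and the radius are fixed, the inequality of [slope_leP]
    defines a relatively closed set of points [x], because [f] is continuous on
    [A].  A sublevel set of the slope is then a countable intersection of
    countable unions of such sets. *)
Lemma measurable_slope A f : open A -> locally_lipschitz_on A f ->
  measurable_fun (A : set (borel X)) (slope f).
Proof.
move=> oA lipf; move=> mA.
pose C (a e d : R) := [set x | forall y, A y -> mdist x y < d ->
  `|f y - f x| <= (a + e) * mdist x y].
have mC a e d : 0 <= a -> 0 < e -> measurable (A `\` C a e d : set (borel X)).
  move=> a0 e0; apply: open_borel; rewrite openE => x [Ax].
  move=> /existsNP[y /not_implyP[Ay /not_implyP[xyk /negP]]]; rewrite -ltNge.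
  move=> gap.
  have [r [L [r0 L0 rA rL]]] := loc_lip_ball oA lipf Ax.
  pose s := (`|f y - f x| - (a + e) * mdist x y) / (L + a + e).
  have Lae : 0 < L + a + e by rewrite ltr_wpDl// addr_ge0.
  have s0 : 0 < s by rewrite divr_gt0// subr_gt0.
  apply/nbhs_ballP; exists (Num.min r (Num.min (d - mdist x y) s)).
    by rewrite /= !lt_min r0 s0 subr_gt0 xyk.
  move=> z; rewrite ball_mdist !lt_min => /and3P[xzr xzd xzs].
  split; first exact: rA.
  apply/existsNP; exists y; apply/not_implyP; split => //.
  have zy := metric_triangle z x y; rewrite (metric_sym z x) in zy.
  apply/not_implyP; split; first by lra.
  apply/negP; rewrite -ltNge.
  have := rL z x xzr; rewrite mdistxx => /(_ r0); rewrite (metric_sym z x) => zx.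
  rewrite /s ltr_pdivlMr// in xzs.
  have /ler_wpM2l-/(_ (a + e)) H := zy.
  have {}H := H (addr_ge0 a0 (ltW e0)).
  have T : `|f y - f x| <= `|f y - f z| + `|f z - f x|.
    have -> : f y - f x = (f y - f z) + (f z - f x) by lra.
    exact: ler_normD.
  nra.
have mle a : 0 <= a -> measurable (A `&` [set x | (slope f x <= a%:E)%E]
    : set (borel X)).
  move=> a0.
  have -> : A `&` [set x | (slope f x <= a%:E)%E] =
      \bigcap_n \bigcup_k (A `\` (A `\` C a n.+1%:R^-1 k.+1%:R^-1)).
    apply/seteqP; split => x /=.
      move=> [Ax /slope_leP-/(_ a0) fx] n _.
      have [r r0 rf] := fx _ (ltac:(by rewrite invr_gt0) : 0 < n.+1%:R^-1).
      have [k kr] := exists_invn_lt r0.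
      exists k => //; split => // -[_]; apply => y Ay xyk.
      by apply: rf; exact: lt_trans kr.
    move=> H; have Ax : A x by have [k _ []] := H 0%N I.
    split => //; apply/slope_leP => // e e0.
    have [n ne] := exists_invn_lt e0; have [k _ [_ Cx]] := H n I.
    have [r [L [r0 _ rA _]]] := loc_lip_ball oA lipf Ax.
    exists (Num.min r k.+1%:R^-1); first by rewrite lt_min r0 invr_gt0/=.
    move=> y; rewrite lt_min => /andP[xyr xyk].
    have {}Cx : C a n.+1%:R^-1 k.+1%:R^-1 x by apply: contrapT => nC; apply: Cx.
    apply: (le_trans (Cx _ (rA _ xyr) xyk)).
    by rewrite ler_wpM2r ?mdist_ge0// lerD2l ltW.
  apply: bigcap_measurable => // n _; apply: bigcup_measurable => k _.
  by apply: measurableD => //; apply: mC; rewrite ?invr_gt0.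
apply: (measurability _ (ErealGenOInfty.measurableE R)) => //.
move=> /= _ [_ [a ->] <-].
have [a0|a0] := ltP a 0.
  rewrite (_ : _ `&` _ = A)//; apply/setIidPl => x Ax /=.
  rewrite in_itv/= andbT; apply: lt_le_trans (slope_ge0 _ _).
  by rewrite lte_fin.
rewrite (_ : _ `&` _ = A `\` (A `&` [set x | (slope f x <= a%:E)%E])).
  by apply: measurableD => //; exact: mle.
apply/seteqP; split => x /=.
  rewrite in_itv/= andbT => -[Ax ax]; split => // -[_].
  by rewrite leNgt ax.
move=> [Ax fx]; split => //; rewrite in_itv/= andbT ltNge.
by apply/negP => H; exact: fx.
Qed.

End slope_theory.

(** * Inferior limits and Tonelli for strips *)

Section limn_einf_lemmas.
Context {R : realType}.
Implicit Types (u v : (\bar R)^nat) (c : \bar R).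
Local Open Scope ereal_scope.

Lemma einfs_le_limn u n : einfs u n <= limn_einf u.
Proof.
rewrite limn_einf_lim (cvg_lim _ (@cvg_einfs_sup _ u))//.
by apply: ereal_sup_ubound; exists n.
Qed.

Lemma limn_einf_lt_frequently u c N : limn_einf u < c ->
  exists2 n, (N <= n)%N & u n < c.
Proof.
move=> /(le_lt_trans (einfs_le_limn u N)).
by move=> /ereal_inf_lt[_ [n /= Nn <-] unc]; exists n.
Qed.

Lemma limn_einf_le u c : (forall N, exists2 n, (N <= n)%N & u n <= c) ->
  limn_einf u <= c.
Proof.
move=> H; rewrite limn_einf_lim; apply: lime_le; first exact: is_cvg_einfs.
apply: nearW => N; have [n Nn unc] := H N.
by apply: ge_ereal_inf; exists (u n) => //; exists n.
Qed.

Lemma le_limn_einf u v : (forall n, u n <= v n) -> limn_einf u <= limn_einf v.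
Proof.
move=> uv; rewrite !limn_einf_lim.
apply: lee_lim; [exact: is_cvg_einfs|exact: is_cvg_einfs|].
apply: nearW => n; apply: le_ereal_inf_tmp => _ [k nk <-].
by apply: ge_ereal_inf; exists (u k) => //; exists k.
Qed.

Lemma limn_einf_ge0 u : (forall n, 0 <= u n) -> 0 <= limn_einf u.
Proof.
move=> u0; apply: le_trans (einfs_le_limn u 0).
by apply: le_ereal_inf_tmp => _ [n _ <-].
Qed.

Lemma limn_einf_superadditive u v : (forall n, 0 <= u n) ->
  (forall n, 0 <= v n) ->
  limn_einf u + limn_einf v <= limn_einf (fun n => u n + v n).
Proof.
move=> u0 v0; have e0 w : (forall n, 0 <= w n) -> forall n, 0 <= einfs w n.
  by move=> w0 n; apply: le_ereal_inf_tmp => _ [k _ <-].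
rewrite !limn_einf_lim -limeD; first last.
- by rewrite ge0_adde_def// inE lime_ge//;
    [exact: is_cvg_einfs|exact/nearW/e0|exact: is_cvg_einfs|exact/nearW/e0].
- exact: is_cvg_einfs.
- exact: is_cvg_einfs.
apply: lee_lim; [|exact: is_cvg_einfs|].
  apply: ereal_nondecreasing_is_cvgn => m n mn.
  by apply: leeD; exact: nondecreasing_einfs.
apply: nearW => n; apply: le_ereal_inf_tmp => _ [k nk <-].
by apply: leeD; apply: ereal_inf_lbound; exists k.
Qed.

Lemma limn_einf_sum_le N (u : nat -> (\bar R)^nat) :
  (forall i n, 0 <= u i n) ->
  \sum_(i < N) limn_einf (u i) <= limn_einf (fun n => \sum_(i < N) u i n).
Proof.
move=> u0; elim: N => [|N IH].
  by rewrite big_ord0; apply: limn_einf_ge0 => n; rewrite big_ord0.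
rewrite big_ord_recr/=; apply: (le_trans (leeD2r _ IH)).
have -> : (fun n => \sum_(i < N.+1) u i n) =
    (fun n => \sum_(i < N) u i n + u N n).
  by apply/funext => n; rewrite big_ord_recr.
by apply: limn_einf_superadditive => // n; exact: sume_ge0.
Qed.

End limn_einf_lemmas.

Section strip.
Context d (T : measurableType d) {R : realType}.
Local Open Scope ereal_scope.

(** Tonelli for the strip between the graphs of [a] and [b], whose vertical
    sections have length [b x - a x].  It serves for the layer-cake formula
    ([a = 0]), for the slopes of ramps ([b = a + delta]), and, with [a = b],
    for the fact that almost every level set is null. *)
Lemma integral_strip (nu : {sigma_finite_measure set T -> \bar R})
    (k : T -> \bar R) (a b : T -> R) :
  measurable_fun setT k -> (forall x, 0 <= k x) ->
  measurable_fun setT a -> measurable_fun setT b -> (forall x, a x <= b x)%R ->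
  measurable_fun setT
    (fun t : R => \int[nu]_x (k x * ((a x <= t <= b x)%R : nat)%:R%:E)) /\
  \int[lebesgue_measure]_t
    (\int[nu]_x (k x * ((a x <= t <= b x)%R : nat)%:R%:E)) =
  \int[nu]_x (k x * (b x - a x)%:E).
Proof.
move=> mk k0 ma mb ab.
pose f (p : T * R) : \bar R := k p.1 * ((a p.1 <= p.2 <= b p.1)%R : nat)%:R%:E.
have f0 p : 0 <= f p by rewrite mule_ge0.
have mf : measurable_fun setT f.
  apply: emeasurable_funM.
    by apply: (measurableT_comp mk); exact: measurable_fst.
  apply/measurable_EFinP.
  have -> : (fun p : T * R => ((a p.1 <= p.2 <= b p.1)%R : nat)%:R : R) =
      \1_[set p : T * R | (a p.1 <= p.2 <= b p.1)%R].
    apply/funext => p; rewrite indicE.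
    congr (nat_of_bool _)%:R.
    by apply/idP/idP; rewrite inE.
  apply: measurable_indic.
  rewrite (_ : mkset _ = (setT `&` [set p : T * R | (a p.1 <= p.2)%R]) `&`
      (setT `&` [set p : T * R | (p.2 <= b p.1)%R])).
    apply: measurableI; apply: measurable_fun_le => //.
    - by apply: (measurableT_comp ma); exact: measurable_fst.
    - by apply: (measurableT_comp mb); exact: measurable_fst.
  apply/seteqP; split => p /=.
    by move=> /andP[].
  by move=> [[_ ->] [_ ->]].
split.
  exact: (measurable_fun_fubini_tonelli_G (m1 := nu) _ mf f0).
have := fubini_tonelli (m1 := nu) (m2 := @lebesgue_measure R) _ mf f0.
rewrite /f /= => <-; apply: eq_integral => x _.
rewrite ge0_integralZl//; last first.
  apply/measurable_EFinP.
  rewrite (_ : (fun y => _) = \1_`[a x, b x]%classic); first exact: measurable_indic.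
  by apply/funext => y /=; rewrite indicE/= mem_setE in_itv.
congr (_ * _).
have -> : (fun y : R => ((a x <= y <= b x)%R : nat)%:R%:E : \bar R) =
    EFin \o \1_`[a x, b x]%classic.
  apply/funext => y /=; rewrite indicE/= mem_setE in_itv/=; by [].
rewrite integral_indic//= setIT lebesgue_measure_itv/= lte_fin.
by case: ltP => // ba; rewrite (@le_anti _ _ (a x) (b x)) ?ab// subrr.
Qed.
End strip.

(** * First properties of the total variation *)

Section convergence_lemmas.
Context {R : realType}.
Local Open Scope ereal_scope.

Lemma ge0_cvg0P (a : (\bar R)^nat) : (forall n, 0 <= a n) ->
  a @ \oo --> 0 <->
  (forall e : R, (0 < e)%R -> exists N, forall n, (N <= n)%N -> a n <= e%:E).
Proof.
move=> a0; split.
  move=> /fine_cvgP[[N _ aN] /cvgrPdist_le H] e e0.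
  have [M _ aM] := H e e0.
  exists (maxn N M) => n; rewrite geq_max => /andP[Nn Mn].
  have an : a n \is a fin_num by exact: aN.
  rewrite -(fineK an) lee_fin; have := aM n Mn.
  by rewrite sub0r normrN /= ger0_norm// fine_ge0.
move=> H; apply/fine_cvgP.
have anf e n : a n <= e%:E -> a n \is a fin_num.
  by move=> ane; rewrite ge0_fin_numE// (le_lt_trans ane)// ltry.
split.
  have [N aN] := H 1%R ltr01; exists N => // n Nn; exact: anf (aN n Nn).
apply/cvgrPdist_le => e e0; have [N aN] := H e e0.
exists N => // n Nn; have an := aN n Nn.
rewrite sub0r normrN /= ger0_norm ?fine_ge0//.
by rewrite -lee_fin fineK// (anf _ _ an).
Qed.

Lemma measurable_fun_limn_einf d (T : measurableType d) (D : set T)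
    (f : (T -> \bar R)^nat) : (forall n, measurable_fun D (f n)) ->
  measurable_fun D (fun x => limn_einf (f ^~ x)).
Proof.
move=> mf.
have -> : (fun x => limn_einf (f ^~ x)) =
    (fun x => - limn_esup (fun n => - f n x)).
  by apply/funext => x; rewrite -limn_einfN; congr limn_einf;
    apply/funext => n /=; rewrite oppeK.
apply: measurableT_comp => //; apply: measurable_fun_limn_esup => n.
exact: measurableT_comp.
Qed.
End convergence_lemmas.

Section total_variation_lemmas.
Context {R : realType} {X : completeMetricType R}.
Implicit Types (mu : {measure set (borel X) -> \bar R}) (A : set X).
Implicit Types (f u : X -> R).

Lemma open_metric_ball (x : X) r : open (ball x r).
Proof.
rewrite openE => y; rewrite ball_mdist => xyr.
apply/nbhs_ballP; exists (r - mdist x y); first by rewrite /= subr_gt0.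
move=> z; rewrite !ball_mdist => yz.
by apply: (le_lt_trans (metric_triangle x y z)); rewrite -ltrBrDl.
Qed.

Lemma measurable_ball (x : X) r : measurable (ball x r : set (borel X)).
Proof. by apply: open_borel; exact: open_metric_ball. Qed.

Lemma finite_on_bounded_ball mu (x : X) r : finite_on_bounded mu ->
  (mu (ball x r) < +oo)%E.
Proof. by move=> fmu; apply: fmu; [exact: measurable_ball|exists x, r]. Qed.

Lemma bigcup_ball (x : X) : \bigcup_n ball x n.+1%:R = [set: X].
Proof.
apply/seteqP; split => // y _; exists (Num.truncn (mdist x y)) => //.
by rewrite ball_mdist truncnS_gt.
Qed.

Lemma finite_on_bounded_sigma_finite mu : finite_on_bounded mu ->
  sigma_finite [set: borel X] mu.
Proof.
move=> fmu; exists (fun n => ball (point : X) n.+1%:R).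
  by rewrite (bigcup_ball (point : X)).
move=> n; split; first exact: measurable_ball.
exact: finite_on_bounded_ball.
Qed.

Lemma finite_on_bounded_mrestr mu (B : set X)
    (mB : measurable (B : set (borel X))) :
  finite_on_bounded mu -> finite_on_bounded (mrestr mu mB).
Proof.
move=> fmu C mC bC; apply: le_lt_trans (fmu C mC bC).
by apply: le_measure; rewrite ?inE//; exact: measurableI.
Qed.

Lemma total_variation_open_ge0 mu f A : (0 <= total_variation_open mu f A)%E.
Proof.
apply: le_ereal_inf_tmp => _ [f_ _ <-]; apply: limn_einf_ge0 => n.
by apply: integral_ge0 => x _; exact: slope_ge0.
Qed.

Lemma cvg_subseq_infty (s : nat -> nat) : (forall n, (n <= s n)%N) ->
  s @ \oo --> \oo.
Proof.
move=> ns P [N _ NP]; exists N => // n /= Nn.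
by apply: NP => /=; exact: leq_trans (ns n).
Qed.

(** Along a subsequence the bound on the inferior limit holds for each term. *)
Lemma total_variation_open_lt mu f A c : (total_variation_open mu f A < c)%E ->
  exists f_ : (X -> R)^nat, [/\ forall n, locally_lipschitz_on A (f_ n),
    L1loc_cvg mu A f_ f &
    forall n, (\int[mu]_(x in A) slope (f_ n) x < c)%E].
Proof.
move=> /ereal_inf_lt[_ [g [lipg gf] <-] gc].
have /choice[s sP] : forall n, exists k, (n <= k)%N /\
    (\int[mu]_(x in A) slope (g k) x < c)%E.
  by move=> n; have [k nk kc] := limn_einf_lt_frequently n gc; exists k.
exists (g \o s); split => [n|x|n]; [exact: lipg| |exact: (sP n).2].
have [U [oU Ux intg intf cvg]] := gf x; exists U; split => //.
  by move=> n; exact: intg.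
apply: (cvg_comp s _ _ cvg).
by apply: cvg_subseq_infty => n; exact: (sP n).1.
Qed.

End total_variation_lemmas.

(** * Ramps around a level *)

Section superlevel_sets.
Context {R : realType} {X : completeMetricType R}.
Implicit Types (mu : {measure set (borel X) -> \bar R}) (A : set X).
Implicit Types (f u : X -> R).

Lemma integral_normr_ge0 mu (D : set X) (g : X -> R) :
  (0 <= \int[mu]_(y in D) `|g y|%:E)%E.
Proof. by apply: integral_ge0 => y _; rewrite lee_fin. Qed.

Definition clamp (a b s : R) : R := Num.min (Num.max s a) b.

Lemma clamp_lipschitz a b s t : `|clamp a b s - clamp a b t| <= `|s - t|.
Proof.
rewrite /clamp; case: (leP (Num.max s a) b);
  case: (leP (Num.max t a) b); case: (leP s a) => sa; case: (leP t a) => ta;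
  have := ler_norm (s - t); have := ler_norm (t - s);
  rewrite (distrC t s) ler_norml => *; lra.
Qed.

Lemma clamp_bounds a b s : a <= b -> a <= clamp a b s <= b.
Proof. by move=> ab; rewrite /clamp le_min ge_min le_max !lexx !orbT ab. Qed.

Definition ramp (t d s : R) : R := clamp 0 1 ((s - t) / d).

Lemma ramp_lipschitz t d r s : 0 < d ->
  `|ramp t d r - ramp t d s| <= d^-1 * `|r - s|.
Proof.
move=> d0; apply: (le_trans (clamp_lipschitz 0 1 _ _)).
rewrite -mulrBl opprB addrA subrK normrM mulrC ler_wpM2r//.
by rewrite ger0_norm// invr_ge0 ltW.
Qed.

Lemma ramp_eq1 t d s : 0 < d -> t + d <= s -> ramp t d s = 1.
Proof.
move=> d0 tds; rewrite /ramp /clamp.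
have H : 1 <= (s - t) / d by rewrite ler_pdivlMr//; lra.
by rewrite max_l ?min_r//; lra.
Qed.

Lemma ramp_eq0 t d s : 0 < d -> s <= t -> ramp t d s = 0.
Proof.
move=> d0 st; rewrite /ramp /clamp.
have H : (s - t) / d <= 0 by rewrite ler_pdivrMr//; lra.
by rewrite max_r// min_l//; lra.
Qed.

Lemma ramp_ge0 t d s : 0 <= ramp t d s.
Proof. by have /andP[] := clamp_bounds ((s - t) / d) (@ler01 R). Qed.

Lemma ramp_le1 t d s : ramp t d s <= 1.
Proof. by have /andP[] := clamp_bounds ((s - t) / d) (@ler01 R). Qed.

(** By continuity of [f], a function [phi] that is constant near the value
    [f x] makes [phi \o f] constant near [x].  Hence the slopes of ramps and
    layers of [f] live on strips of values of [f]. *)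
Lemma slope_comp_flat A f (phi : R -> R) x e : open A ->
  locally_lipschitz_on A f -> A x -> 0 < e ->
  (forall s, `|s - f x| < e -> phi s = phi (f x)) -> slope (phi \o f) x = 0%E.
Proof.
move=> oA lipf Ax e0 flat.
have [r [L [r0 L0 rA rL]]] := loc_lip_ball oA lipf Ax.
have L1 : 0 < L + 1 by rewrite ltr_wpDl.
apply: (@slope_locally_constant _ _ _ _ (Num.min r (e / (L + 1)))).
  by rewrite lt_min r0 divr_gt0.
move=> y; rewrite lt_min ltr_pdivlMr// => /andP[yr ye] /=; apply: flat.
have := rL y x yr; rewrite mdistxx => /(_ r0) H; apply: (le_lt_trans H).
by rewrite (metric_sym y x); have := mdist_ge0 x y; nra.
Qed.

Lemma integrable_bounded mu (B : set (borel X)) f (M : R) : measurable B ->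
  (mu B < +oo)%E -> measurable_fun B f -> (forall x, B x -> `|f x| <= M) ->
  mu.-integrable B (EFin \o f).
Proof.
move=> mB fB mf fM; apply: measurable_bounded_integrable => //.
exists M; split; first exact: num_real.
by move=> K MK x Bx; apply: le_trans (ltW MK); exact: fM.
Qed.

Lemma measurable_superlevel u t : measurable_fun [set: borel X] u ->
  measurable ([set x | t < u x] : set (borel X)).
Proof.
move=> mu_; have := mu_ measurableT _ (measurable_itv `]t, +oo[).
rewrite setTI (_ : _ @^-1` _ = [set x | t < u x])//.
by apply/seteqP; split => x /=; rewrite in_itv/= andbT.
Qed.

Lemma measurable_level u t : measurable_fun [set: borel X] u ->
  measurable ([set x | u x = t] : set (borel X)).
Proof.
by move=> mu_; have := mu_ measurableT _ (measurable_set1 t); rewrite setTI.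
Qed.

(** If the ramp of [f_ n x] differs from the indicator at [x], then either
    [u x] is within [eta] of the level [t], or [f_ n x] is at least [eta / 2]
    away from [u x].  The first set is small since the level set is null, and
    the second alternative is absorbed by the L^1 distance. *)
Lemma L1loc_cvg_ramp mu A u (f_ : (X -> R)^nat) t (d : R^nat) :
  finite_on_bounded mu -> open A -> measurable_fun [set: borel X] u ->
  (forall n, locally_lipschitz_on A (f_ n)) -> L1loc_cvg mu A f_ u ->
  mu (A `&` [set x | u x = t]) = 0%E ->
  (forall n, 0 < d n) -> (forall e, 0 < e -> exists N, forall n, (N <= n)%N ->
     d n <= e) ->
  L1loc_cvg mu A (fun n => ramp t (d n) \o f_ n)
    \1_(A `&` [set x | t < u x]).
Proof.
move=> fmu oA mu_ lipf cvgf ut0 d0 d_0 x.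
have [U [oU Ux intf intu cvgU]] := cvgf x.
(* The neighbourhood is cut down to finite measure, where bounded functions
   are integrable. *)
pose V := U `&` ball x 1; pose B := V `&` A.
have oV : open V.
  apply: openI => //; exact: open_metric_ball.
have mB : measurable (B : set (borel X)) by apply: open_borel; exact: openI.
have fB : (mu B < +oo)%E.
  by apply: fmu => //; exists x, 1 => y [[]].
have BUA : B `<=` U `&` A by move=> y [[]].
have BA : B `<=` A by move=> y [[]].
have mUA : measurable (U `&` A : set (borel X)).
  by apply: open_borel; exact: openI.
have mE : measurable (A `&` [set x | t < u x] : set (borel X)).
  apply: measurableI; first exact: open_borel.
  exact: measurable_superlevel.
have mA : measurable (A : set (borel X)) by exact: open_borel.
have mg n : measurable_fun (B : set (borel X)) (ramp t (d n) \o f_ n).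
  apply: (measurable_funS mA BA).
  apply: measurable_loc_lip => //.
  apply: (@locally_lipschitz_comp _ _ _ (d n)^-1) => // [|r s].
    by rewrite invr_ge0 ltW.
  exact: ramp_lipschitz.
have m1 : measurable_fun (B : set (borel X)) (\1_(A `&` [set x | t < u x]) : X -> R).
  exact: measurable_indic.
exists V; split => //; first by split => //; exact: ballxx.
- move=> n; apply: (@integrable_bounded _ _ _ 1) => // y _ /=.
  by rewrite ger0_norm ?ramp_le1 ?ramp_ge0.
- apply: (@integrable_bounded _ _ _ 1) => // y _ /=.
  by rewrite indicE ger0_norm//; case: (_ \in _).
apply/ge0_cvg0P => [n|e e0]; first by apply: integral_ge0 => y _; rewrite lee_fin.
pose S k := B `&` [set y | `|u y - t| <= k.+1%:R^-1].
have mS k : measurable (S k : set (borel X)).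
  apply: measurableI => //; rewrite -[X in measurable X]setTI.
  apply: measurable_fun_le => //; apply: measurableT_comp => //.
  exact: measurable_funB.
have S0 : (mu \o S) k @[k --> \oo] --> mu (\bigcap_k S k).
  apply: nonincreasing_cvg_mu => //.
  - apply: le_lt_trans fB; apply: le_measure; rewrite ?inE//.
    by move=> y [].
  - exact: bigcapT_measurable.
  - move=> i j ij; apply/subsetPset => y [By /= uy]; split => //=.
    by apply: le_trans uy _; rewrite lef_pV2 ?posrE// ler_nat ltnS.
have capS : mu (\bigcap_k S k) = 0%E.
  apply/eqP; rewrite eq_le measure_ge0 andbT -ut0; apply: le_measure.
  - by rewrite inE; exact: bigcapT_measurable.
  - rewrite inE; apply: measurableI; first exact: open_borel.
    exact: measurable_level.
  move=> y yS; split; first by apply: BA; exact: (yS 0%N I).1.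
  apply/eqP; rewrite -subr_eq0 -normr_eq0; apply/negPn/negP => yt.
  have [k] : exists k, k.+1%:R^-1 < `|u y - t|.
    by apply: exists_invn_lt; rewrite lt_neqAle eq_sym yt normr_ge0.
  by apply/negP; rewrite -leNgt; exact: (yS k I).2.
rewrite capS in S0.
have e20 : 0 < e / 2 by rewrite divr_gt0.
have /ge0_cvg0P-/(_ (fun=> measure_ge0 _ _))/(_ _ e20)[k kS] := S0.
have {}kS : (mu (S k) <= (e / 2)%:E)%E by exact: kS.
pose eta : R := k.+1%:R^-1; have eta0 : 0 < eta by rewrite invr_gt0.
have eta20 : 0 < eta / 2 by rewrite divr_gt0.
have [N1 dN1] := d_0 _ eta20.
have ee : 0 < (eta / 2) * (e / 2) by rewrite mulr_gt0.
have /ge0_cvg0P H := cvgU.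
have [N2 fN2] := H (fun n => integral_normr_ge0 _ _ _) _ ee.
exists (maxn N1 N2) => n; rewrite geq_max => /andP[N1n N2n].
have {}dN1 := dN1 n N1n; have {}fN2 := fN2 n N2n.
have mfu : measurable_fun (B : set (borel X)) (fun y => `|f_ n y - u y|).
  apply: measurableT_comp => //; apply: measurable_funB.
    apply: (measurable_funS mA BA).
    exact: measurable_loc_lip.
  exact: measurable_funTS.
apply: (@le_trans _ _ (\int[mu]_(y in B) ((\1_(S k) y)%:E +
    ((eta / 2)^-1)%:E * `|f_ n y - u y|%:E))%E).
  apply: ge0_le_integral => //.
  - apply/measurable_EFinP; apply: measurableT_comp => //.
    exact: measurable_funB.
  - apply: emeasurable_funD; first by apply/measurable_EFinP; exact: measurable_indic.
    by apply: measurable_funeM; exact/measurable_EFinP.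
  move=> y By; rewrite -EFinM -EFinD lee_fin !indicE.
  have g0 := ramp_ge0 t (d n) (f_ n y); have g1 := ramp_le1 t (d n) (f_ n y).
  have dn := d0 n.
  have q0 : 0 <= (eta / 2)^-1 * `|f_ n y - u y|.
    by rewrite mulr_ge0// invr_ge0 ltW.
  have [uyt|] := leP `|u y - t| eta.
    rewrite (_ : (y \in S k) = true); last exact/mem_set.
    by apply: (@le_trans _ _ 1); [rewrite ler_norml; case: (_ \in _) => /=; lra|rewrite /=; lra].
  rewrite ltr_normr => uyt; apply: ler_wpDl; first by [].
  have q1 : eta / 2 <= `|f_ n y - u y| -> 1 <= (eta / 2)^-1 * `|f_ n y - u y|.
    by move=> ?; rewrite mulrC ler_pdivlMr// mul1r.
  have l1 := ler_norm (f_ n y - u y); have l2 := ler_norm (u y - f_ n y).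
  rewrite (distrC (u y)) in l2.
  case/orP: uyt => uyt.
    rewrite (_ : (y \in _) = true) /=; last by apply/mem_set; split; [exact: BA|rewrite /=; lra].
    have [fy|fy] := leP (t + d n) (f_ n y).
      by rewrite ramp_eq1// subrr normr0.
    by apply: (@le_trans _ _ 1); [rewrite ler_norml; lra|apply: q1; lra].
  rewrite (_ : (y \in _) = false) /=; last first.
    by apply/negbTE/negP => /set_mem[_] /=; lra.
  have [fy|fy] := leP (f_ n y) t.
    by rewrite ramp_eq0// subrr normr0.
  by apply: (@le_trans _ _ 1); [rewrite ler_norml; lra|apply: q1; lra].
rewrite ge0_integralD//; first last.
- by apply: measurable_funeM; exact/measurable_EFinP.
- by move=> y _; rewrite -EFinM lee_fin mulr_ge0// invr_ge0 ltW.
- by apply/measurable_EFinP; exact: measurable_indic.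
rewrite integral_indic//.
rewrite ge0_integralZl//; first last.
- by rewrite lee_fin invr_ge0 ltW.
- exact/measurable_EFinP.
rewrite [e in (_ <= e%:E)%E]splitr EFinD; apply: leeD.
  by rewrite (_ : S k `&` B = S k)//; apply/setIidPl => y [].
rewrite lee_pdivrMl// -EFinM; apply: le_trans fN2.
apply: ge0_subset_integral => //.
apply/measurable_EFinP; apply: measurableT_comp => //; apply: measurable_funB.
  by apply/measurable_EFinP; exact: measurable_int (intf n).
exact: measurable_funTS.
Qed.

End superlevel_sets.

(** * A superlevel set of small perimeter *)

Section sigma_finite_copy.
Context d (T : measurableType d) {R : realType} (mu : {measure set T -> \bar R}).

(** A name for [mu] to which sigma-finiteness is attached as a structure, the
    form in which Tonelli takes it. *)
Definition sigma_finite_copy of sigma_finite [set: T] mu : set T -> \bar R := mu.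

Context (h : sigma_finite [set: T] mu).

HB.instance Definition _ := Measure.copy (sigma_finite_copy h) mu.
HB.instance Definition _ :=
  Measure_isSigmaFinite.Build _ _ _ (sigma_finite_copy h) h.
End sigma_finite_copy.

Section level_selection.
Context {R : realType} {X : completeMetricType R}.
Implicit Types (mu : {measure set (borel X) -> \bar R}) (A : set X).
Implicit Types (f u : X -> R).
Local Open Scope ereal_scope.

(** A weak form of the coarea inequality.  Let [M t] be the measure of the
    superlevel set and [K n t] the integral of the slope of the ramp of [f_n]
    at level [t].  The integrals of [M] and [K n] over the levels are bounded by
    the L^1 norm of [u] and by the integral of the slope of [f_n], so by Fatou
    the function [M + liminf K n] has integral less than [c] over (0, h).  At
    some level it is at most c / h, and such a level can be chosen with a null
    level set, where [liminf K n] dominates the perimeter because the ramps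
    converge to the indicator. *)
Lemma coarea_level mu A u (h c : R) :
  finite_on_bounded mu -> open A -> mu.-integrable [set: borel X] (EFin \o u) ->
  (0 < h)%R ->
  \int[mu]_(x in A) `|u x|%:E + total_variation_open mu u A < c%:E ->
  exists t, [/\ (0 < t)%R, (t < h)%R &
    h%:E * (mu (A `&` [set x | (t < u x)%R]) +
      total_variation_open mu \1_(A `&` [set x | (t < u x)%R]) A) <= c%:E].
Proof.
move=> fmu oA iu h0.
have mA : measurable (A : set (borel X)) by exact: open_borel.
have mu_ : measurable_fun [set: borel X] u.
  by apply/measurable_EFinP; exact: measurable_int iu.
set I := \int[mu]_(x in A) `|u x|%:E; set V := total_variation_open mu u A => IVc.
have V0 : 0 <= V by exact: total_variation_open_ge0.
have I0 : 0 <= I by exact: integral_normr_ge0.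
have I_fin : I \is a fin_num.
  by rewrite ge0_fin_numE// (le_lt_trans _ (lt_trans IVc (ltry _)))// leeDl.
have [c1 Vc1 c1c] : exists2 c1 : R, V < c1%:E & I + c1%:E < c%:E.
  have V_fin : V \is a fin_num.
    by rewrite ge0_fin_numE// (le_lt_trans _ (lt_trans IVc (ltry _)))// leeDr.
  move: IVc; rewrite -(fineK I_fin) -(fineK V_fin) -EFinD lte_fin => IVc.
  exists ((fine V + (c - fine I)) / 2)%R.
    by rewrite lte_fin; lra.
  by rewrite -EFinD lte_fin; lra.
have {Vc1} [f_ [lipf cvgf fc1]] := total_variation_open_lt Vc1.
pose nu : {sigma_finite_measure set (borel X) -> \bar R} :=
  sigma_finite_copy (finite_on_bounded_sigma_finite fmu).
pose delta (n : nat) : R := (n.+1%:R^-1)%R.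
have d0 n : (0 < delta n)%R by rewrite invr_gt0.
pose sf n := slope (f_ n) \_ A; pose fr n := f_ n \_ A.
have msf n : measurable_fun [set: borel X] (sf n).
  exact: (measurable_restrictT _ mA).1 (measurable_slope oA (lipf n)).
have mfr n : measurable_fun [set: borel X] (fr n).
  exact: (measurable_restrictT _ mA).1 (measurable_loc_lip oA (lipf n)).
have sf0 n x : 0 <= sf n x.
  by rewrite /sf patchE; case: ifPn => // _; exact: slope_ge0.
(* The slope of the ramp of [f_ n] at [t] is at most [(delta n)^-1] times that
   of [f_ n], and vanishes unless [t <= f_ n x <= t + delta n]. *)
pose K n (t : R) := \int[mu]_x (((delta n)^-1)%:E * sf n x *
  ((fr n x - delta n <= t <= fr n x)%R : nat)%:R%:E).
have K0 n t : 0 <= K n t.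
  apply: integral_ge0 => x _; rewrite !mule_ge0//.
  by rewrite lee_fin invr_ge0 ltW.
have [mK iK] : (forall n, measurable_fun setT (K n)) /\
    forall n, \int[lebesgue_measure]_t K n t = \int[mu]_(x in A) slope (f_ n) x.
  suff H n : measurable_fun setT (K n) /\
      \int[lebesgue_measure]_t K n t = \int[mu]_(x in A) slope (f_ n) x.
    by split => n; [exact: (H n).1|exact: (H n).2].
  have [] := @integral_strip _ (borel X) R nu (fun x => ((delta n)^-1)%:E * sf n x)
    (fun x => fr n x - delta n)%R (fr n).
  - exact: measurable_funeM.
  - by move=> x; rewrite mule_ge0// lee_fin invr_ge0 ltW.
  - exact: measurable_funB.
  - exact: mfr.
  - by move=> x; rewrite gerBl ltW.
  move=> mK iK; split; first exact: mK.
  rewrite [LHS]iK [RHS]integral_mkcond; apply: eq_integral => x _.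
  rewrite muleAC -EFinM opprB addrC subrK mulVf ?gt_eqF// mul1e.
  by [].
pose k1 (x : X) : \bar R := (\1_A x)%:E.
have mk1 : measurable_fun [set: borel X] k1.
  by apply/measurable_EFinP; exact: measurable_indic.
have k10 x : 0 <= k1 x by rewrite lee_fin.
pose up x := Num.max (u x) 0%R.
have mup : measurable_fun [set: borel X] up by exact: measurable_maxr.
have up0 x : (0 <= up x)%R by rewrite /up le_max lexx orbT.
have m0 : measurable_fun [set: borel X] (fun=> 0 : R)%R by exact: measurable_cst.
(* [M t] is the measure of [u >= t] and [Z t] that of [u = t], within [A]. *)
have [mM iM] := integral_strip nu mk1 k10 m0 mup up0.
have [mZ iZ] := integral_strip nu mk1 k10 mu_ mu_ (fun x => lexx (u x)).
set M := (fun t : R => \int[nu]_x _) in mM iM.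
set Z := (fun t : R => \int[nu]_x _) in mZ iZ.
have M0 t : 0 <= M t by apply: integral_ge0 => x _; rewrite mule_ge0.
have Z0 t : 0 <= Z t by apply: integral_ge0 => x _; rewrite mule_ge0.
have mab (a b : X -> R) (t : R) : measurable_fun [set: borel X] a ->
    measurable_fun [set: borel X] b ->
    measurable ([set x | (a x <= t <= b x)%R] : set (borel X)).
  move=> ma mb.
  rewrite (_ : mkset _ = (setT `&` [set x | (a x <= t)%R]) `&`
      (setT `&` [set x | (t <= b x)%R])).
    by apply: measurableI; apply: measurable_fun_le.
  apply/seteqP; split => x /=; first by move=> /andP[].
  by move=> [[_ ->] [_ ->]].
have kI (a b : X -> R) (t : R) : measurable_fun [set: borel X] a ->
    measurable_fun [set: borel X] b ->
    \int[mu]_x (k1 x * ((a x <= t <= b x)%R : nat)%:R%:E) =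
    mu (A `&` [set x | (a x <= t <= b x)%R]).
  move=> ma mb.
  have mS := mab a b t ma mb.
  transitivity (\int[mu]_x (\1_(A `&` [set x | (a x <= t <= b x)%R]) x)%:E).
    apply: eq_integral => x _; rewrite /k1 -EFinM indicI; congr (_ * _)%:E.
    rewrite [in RHS]indicE; congr (nat_of_bool _)%:R.
    by apply/idP/idP => [?|/set_mem//]; exact/mem_set.
  by rewrite integral_indic ?setIT//; exact: measurableI.
have ME t : M t = mu (A `&` [set x | (0 <= t <= up x)%R]) by exact: kI.
have ZE t : Z t = mu (A `&` [set x | u x = t]).
  rewrite /Z [LHS]kI//; congr (mu (A `&` _)).
  apply/seteqP; split => x /=; first by move=> /le_anti.
  by move=> ->; rewrite lexx.
have aeZ : {ae lebesgue_measure, forall t, Z t = 0}.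
  have : \int[lebesgue_measure]_t `|Z t| = 0.
    transitivity (\int[lebesgue_measure]_t Z t).
      by apply: eq_integral => t _; rewrite gee0_abs.
    by rewrite iZ integral0_eq// => x _; rewrite subrr mule0.
  move=> /(ae_eq_integral_abs (@lebesgue_measure R) measurableT mZ).1.
  by apply: filterS => t; apply.
pose D : set R := `]0%R, h[%classic.
have mD : measurable D by exact: measurable_itv.
have Dh : @lebesgue_measure R D = h%:E.
  by rewrite /D lebesgue_measure_itv/= lte_fin h0 sube0.
pose G t := M t + limn_einf (K ^~ t).
have mG : measurable_fun setT G.
  by apply: emeasurable_funD => //; exact: measurable_fun_limn_einf.
have G0 t : 0 <= G t by rewrite adde_ge0// limn_einf_ge0.
have iG : \int[lebesgue_measure]_(t in D) G t < c%:E.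
  apply: le_lt_trans c1c; rewrite ge0_integralD//; first last.
  - by apply: measurable_funTS; exact: measurable_fun_limn_einf.
  - by move=> t _; exact: limn_einf_ge0.
  - exact: measurable_funTS.
  apply: leeD.
    apply: (@le_trans _ _ (\int[lebesgue_measure]_t M t)).
      exact: ge0_subset_integral.
    rewrite iM /I [leRHS]integral_mkcond; apply: ge0_le_integral => //.
    - by move=> x _; rewrite mule_ge0// lee_fin subr0.
    - apply: emeasurable_funM => //; apply/measurable_EFinP.
      exact: measurable_funB.
    - apply/(measurable_restrictT _ mA)/measurable_EFinP.
      by apply: measurable_funTS; exact: measurableT_comp.
    move=> x _; rewrite patchE /k1 indicE subr0; case: ifPn => _.
      by rewrite mul1e lee_fin /up ge_max normr_ge0 ler_norm.
    by rewrite mul0e.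
  have mKD n : measurable_fun D (K n) by exact: measurable_funTS.
  apply: (le_trans (fatou (@lebesgue_measure R) mD mKD (fun n t _ => K0 n t))).
  apply: limn_einf_le => N; exists N => //.
  apply: le_trans (ltW (fc1 N)); rewrite -iK.
  by apply: ge0_subset_integral => //; exact: mK.
have [t [Dt Zt Gt]] : exists t, [/\ D t, Z t = 0 & h%:E * G t <= c%:E].
  apply: contrapT => noT.
  have big t : D t -> Z t = 0 -> (c / h)%:E <= G t.
    move=> Dt Zt; rewrite leNgt; apply/negP => Gt; apply: noT; exists t; split => //.
    by rewrite -lee_pdivlMl// -EFinM mulrC ltW.
  have c0 : (0 < c)%R.
    by rewrite -lte_fin; apply: le_lt_trans IVc; exact: adde_ge0.
  have : c%:E <= \int[lebesgue_measure]_(t in D) G t.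
    apply: (@le_trans _ _ (\int[lebesgue_measure]_(t in D) (cst (c / h)%:E t))).
      rewrite integral_cst// [X in (_ * X)%E]Dh -EFinM.
      by rewrite mulfVK// gt_eqF.
    apply: ae_ge0_le_integral => //.
    - by move=> t _; rewrite /= lee_fin divr_ge0// ltW.
    - exact: measurable_funTS.
    - apply: (@filterS _ _ (ae_filter_ringOfSetsType (@lebesgue_measure R)) _ _ _ aeZ).
      by move=> t Zt Dt; exact: big.
  by rewrite leNgt iG.
exists t; move: Dt; rewrite /D /= in_itv/= => /andP[t0 th]; split => //.
apply: le_trans Gt; rewrite lee_pmul2l//; apply: leeD.
  rewrite ME; apply: le_measure.
  - by rewrite inE; apply: measurableI => //; exact: measurable_superlevel.
  - rewrite inE; apply: measurableI => //.
    exact: mab.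
  by move=> x [Ax /= tu]; split => //=; rewrite ltW//= /up le_max ltW.
apply: (@le_trans _ _ (limn_einf (fun n =>
    \int[mu]_(x in A) slope (ramp t (delta n) \o f_ n) x))).
  apply: ereal_inf_lbound; exists (fun n => ramp t (delta n) \o f_ n) => //.
  split.
    move=> n; apply: (@locally_lipschitz_comp _ _ _ (delta n)^-1) => //.
      by rewrite invr_ge0 ltW.
    by move=> r s; exact: ramp_lipschitz.
  apply: L1loc_cvg_ramp => //; first by rewrite -ZE.
  move=> e e0; have [N Ne] := exists_invn_lt e0; exists N => n Nn.
  apply: le_trans (ltW Ne).
  by rewrite lef_pV2 ?posrE// ler_nat ltnS.
apply: le_limn_einf => n.
have lipg : locally_lipschitz_on A (ramp t (delta n) \o f_ n).
  apply: (@locally_lipschitz_comp _ _ _ (delta n)^-1) => //.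
    by rewrite invr_ge0 ltW.
  by move=> r s; exact: ramp_lipschitz.
rewrite /K integral_mkcond; apply: ge0_le_integral => //.
- by move=> x _; rewrite patchE; case: ifPn => // _; exact: slope_ge0.
- exact: (measurable_restrictT _ mA).1 (measurable_slope oA lipg).
- apply: emeasurable_funM; first exact: measurable_funeM.
  apply/measurable_EFinP.
  rewrite (_ : (fun x => _) =
      \1_[set x | (fr n x - delta n <= t <= fr n x)%R]).
    by apply: measurable_indic; apply: mab => //; exact: measurable_funB.
  apply/funext => x; rewrite indicE; congr (nat_of_bool _)%:R.
  by apply/idP/idP => [?|/set_mem//]; exact/mem_set.
move=> x _; rewrite /sf /fr !patchE; case: ifPn => [/set_mem Ax|_]; last first.
  by rewrite mule0 mul0e.
have dn := d0 n.
have [/andP[tf ft]|] := boolP (_ <= t <= _)%R.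
  rewrite mule1; apply: slope_comp => [|r s]; first by rewrite invr_ge0 ltW.
  exact: ramp_lipschitz.
rewrite negb_and -!ltNge mule0 => /orP tf.
have [e e0 flat] : exists2 e : R, (0 < e)%R & forall s, (`|s - f_ n x| < e)%R ->
    ramp t (delta n) s = ramp t (delta n) (f_ n x).
  case: tf => tf; [exists (f_ n x - delta n - t)%R|exists (t - f_ n x)%R].
  - by lra.
  - by move=> s; rewrite ltr_norml => /andP[h1 h2]; rewrite !ramp_eq1//; lra.
  - by lra.
  - by move=> s; rewrite ltr_norml => /andP[h1 h2]; rewrite !ramp_eq0//; lra.
by rewrite (slope_comp_flat oA (lipf n) Ax e0 flat).
Qed.
End level_selection.

(** * Approximation on balls by locally Lipschitz functions *)

Section approximable.
Context {R : realType} {X : completeMetricType R}.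
Implicit Types (m : {measure set (borel X) -> \bar R}) (f g u v : X -> R).

(** The centre of the balls is fixed once and for all, and integrability on
    every ball is what makes [g] admissible as a term of an L^1_loc
    approximation, where all terms are integrable on one neighbourhood. *)
Definition approximates m u (c e r : R) g :=
  [/\ locally_lipschitz_on [set: X] g,
    forall r, m.-integrable (ball (point : X) r) (EFin \o g),
    (\int[m]_(x in [set: X]) slope g x <= (c + e)%:E)%E &
    (\int[m]_(x in ball (point : X) r) `|g x - u x|%:E <= e%:E)%E].

(** A variant of [total_variation m u [set: X] <= c] in which the region of
    approximation grows as the error shrinks.  A fixed ball is eventually
    contained in these regions, so that diagonal arguments work. *)
Definition approximable m u (c : R) := forall e : R, 0 < e ->
  exists g, approximates m u c e e^-1 g.

Lemma measurable_loc_lipT g : locally_lipschitz_on [set: X] g ->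
  measurable_fun [set: borel X] g.
Proof. by move=> lipg; apply: measurable_loc_lip => //; exact: openT. Qed.

Lemma measurable_slopeT g : locally_lipschitz_on [set: X] g ->
  measurable_fun [set: borel X] (slope g).
Proof. by move=> lipg; apply: measurable_slope => //; exact: openT. Qed.

Lemma ball_mdist_sub (x : X) r : ball x r `<=` ball (point : X) (mdist (point : X) x + r).
Proof.
move=> y; rewrite !ball_mdist => xy.
by apply: (le_lt_trans (metric_triangle _ x _)); rewrite ltrD2l.
Qed.

Lemma measurable_normrB (D : set (borel X)) g u : measurable_fun [set: borel X] g ->
  measurable_fun [set: borel X] u ->
  measurable_fun D (fun x => `|g x - u x|%:E).
Proof.
move=> mg mu_; apply/measurable_EFinP; apply: measurable_funTS.
by apply: measurableT_comp => //; exact: measurable_funB.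
Qed.

(** The approximants for the errors 1 / (n + 1) converge to [u] on the unit
    ball around any point, which lies in ball n + 1 for large [n]. *)
Lemma approximable_total_variation m u c : finite_on_bounded m ->
  m.-integrable [set: borel X] (EFin \o u) -> approximable m u c ->
  (total_variation_open m u [set: X] <= c%:E)%E.
Proof.
move=> fm iu uc.
have mu_ : measurable_fun [set: borel X] u.
  by apply/measurable_EFinP; exact: measurable_int iu.
have /choice[g gP] : forall n : nat, exists g,
    approximates m u c n.+1%:R^-1 n.+1%:R g.
  move=> n; have n0 : 0 < n.+1%:R^-1 :> R by rewrite invr_gt0.
  by have := uc _ n0; rewrite invrK.
apply: (@le_trans _ _ (limn_einf (fun n => \int[m]_(x in [set: X]) slope (g n) x)%E)).
  apply: ereal_inf_lbound; exists g => //; split => [n|x]; first by have [] := gP n.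
  exists (ball x 1); rewrite setIT; split.
  - exact: open_metric_ball.
  - exact: ballxx.
  - move=> n; have [_ ig _ _] := gP n.
    apply: integrableS (ig (mdist (point : X) x + 1)); try exact: measurable_ball.
    exact: ball_mdist_sub.
  - by apply: integrableS iu => //; exact: measurable_ball.
  apply/ge0_cvg0P => [n|e e0]; first exact: integral_normr_ge0.
  have [N Ne] := exists_invn_lt e0.
  exists (maxn N (Num.truncn (mdist (point : X) x + 1))) => n.
  rewrite geq_max => /andP[Nn xn].
  have [/measurable_loc_lipT mg _ _ gn] := gP n.
  apply: (@le_trans _ _ n.+1%:R^-1%:E); last first.
    rewrite lee_fin; apply: le_trans (ltW Ne).
    by rewrite lef_pV2 ?posrE// ler_nat ltnS.
  apply: le_trans gn; apply: ge0_subset_integral => //; try exact: measurable_ball.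
    exact: measurable_normrB.
  apply: (subset_trans (@ball_mdist_sub x 1)); apply: le_ball.
  by apply: (le_trans (ltW (truncnS_gt _))); rewrite ler_nat ltnS.
apply/lee_addgt0Pr => e e0; rewrite -EFinD; apply: limn_einf_le => N.
have [M Me] := exists_invn_lt e0; exists (maxn N M); first exact: leq_maxl.
have [_ _ gn _] := gP (maxn N M); apply: (le_trans gn).
rewrite lee_fin lerD2l; apply: le_trans (ltW Me).
by rewrite lef_pV2 ?posrE// ler_nat ltnS leq_maxr.
Qed.

(** This lets a proof spend a fraction [e'] of the error: the ball of radius
    [e'^-1] that comes with it is the larger one. *)
Lemma approximates_larger_ball m u c e : measurable_fun [set: borel X] u ->
  0 < e -> (exists2 e', 0 < e' <= e & exists g, approximates m u c e e'^-1 g) ->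
  exists g, approximates m u c e e^-1 g.
Proof.
move=> mu_ e0 [e' /andP[e'0 e'e] [g [lipg ig sg gu]]]; exists g; split => //.
apply: le_trans gu; apply: ge0_subset_integral => //; try exact: measurable_ball.
  by apply: measurable_normrB => //; exact: measurable_loc_lipT.
by apply: le_ball; rewrite lef_pV2.
Qed.

Lemma approximable_add m u v c d : measurable_fun [set: borel X] u ->
  measurable_fun [set: borel X] v -> approximable m u c -> approximable m v d ->
  approximable m (fun x => u x + v x) (c + d).
Proof.
move=> mu_ mv uc vd e e0; apply: approximates_larger_ball => //; first exact: measurable_funD.
have e20 : 0 < e / 2 by rewrite divr_gt0.
exists (e / 2); first by rewrite e20/=; lra.
have [g [lipg ig sg gu]] := uc _ e20; have [h [liph ih sh hv]] := vd _ e20.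
have mg := measurable_loc_lipT lipg; have mh := measurable_loc_lipT liph.
exists (fun x => g x + h x); split.
- exact: locally_lipschitz_add.
- by move=> r; apply: integrableD (ig r) (ih r); exact: measurable_ball.
- apply: (@le_trans _ _ (\int[m]_(x in [set: X]) (slope g x + slope h x))%E).
    apply: ge0_le_integral => //.
    + by move=> x _; exact: slope_ge0.
    + by apply: measurable_slopeT; exact: locally_lipschitz_add.
    + by apply: emeasurable_funD; exact: measurable_slopeT.
    + by move=> x _; exact: slope_add.
  rewrite ge0_integralD//; try by move=> x _; exact: slope_ge0.
  + apply: (le_trans (leeD sg sh)); rewrite -EFinD lee_fin; lra.
  + exact: measurable_slopeT.
  + exact: measurable_slopeT.
apply: (@le_trans _ _ (\int[m]_(x in ball (point : X) (e / 2)^-1)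
    (`|g x - u x|%:E + `|h x - v x|%:E))%E).
  apply: ge0_le_integral => //; try exact: measurable_ball.
  - by apply: measurable_normrB; exact: measurable_funD.
  - by apply: emeasurable_funD; exact: measurable_normrB.
  - by move=> x _; rewrite -EFinD lee_fin opprD addrACA ler_normD.
rewrite ge0_integralD//; try exact: measurable_normrB; last exact: measurable_ball.
apply: (le_trans (leeD gu hv)); rewrite -EFinD lee_fin; lra.
Qed.

Lemma approximable_scale m u c a : measurable_fun [set: borel X] u ->
  approximable m u c -> approximable m (fun x => a * u x) (`|a| * c).
Proof.
move=> mu_ uc e e0; apply: approximates_larger_ball => //; first exact: measurable_funM.
have a1 : 0 < `|a| + 1 by rewrite ltr_wpDl.
have e'0 : 0 < e / (`|a| + 1) by rewrite divr_gt0.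
have ae : `|a| * (e / (`|a| + 1)) <= e.
  by rewrite mulrCA ler_piMr ?(ltW e0)// ler_pdivrMr// mul1r lerDl.
exists (e / (`|a| + 1)).
  by rewrite e'0/= ler_pdivrMr// ler_peMr ?(ltW e0)// lerDr.
have [g [lipg ig sg gu]] := uc _ e'0; have mg := measurable_loc_lipT lipg.
have lipa s t : `|a * s - a * t| <= `|a| * `|s - t| by rewrite -mulrBr normrM.
have lipag : locally_lipschitz_on [set: X] (fun x => a * g x).
  exact: (locally_lipschitz_comp _ lipa lipg).
exists (fun x => a * g x); split => //.
- by move=> r; apply: (integrableZl (measurable_ball _ _) a (ig r)).
- apply: (@le_trans _ _ (\int[m]_(x in [set: X]) (`|a|%:E * slope g x))%E).
    apply: ge0_le_integral => //.
    + by move=> x _; exact: slope_ge0.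
    + exact: measurable_slopeT.
    + by apply: measurable_funeM; exact: measurable_slopeT.
    + by move=> x _; exact: (@slope_comp _ _ ( *%R a) _ g x (normr_ge0 a) lipa).
  rewrite ge0_integralZl//; last 2 first.
  + exact: measurable_slopeT.
  + by move=> x _; exact: slope_ge0.
  apply: (@le_trans _ _ (`|a|%:E * (c + e / (`|a| + 1))%:E)%E).
    by rewrite lee_wpmul2l.
  by rewrite -EFinM lee_fin mulrDr lerD2l.
apply: (@le_trans _ _ (\int[m]_(x in ball (point : X) (e / (`|a| + 1))^-1)
    (`|a|%:E * `|g x - u x|%:E))%E).
  apply: ge0_le_integral => //; try exact: measurable_ball.
  - by apply: measurable_normrB; exact: measurable_funM.
  - by apply: measurable_funeM; exact: measurable_normrB.
  - by move=> x _; rewrite -EFinM lee_fin.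
rewrite ge0_integralZl//; try exact: measurable_normrB; last exact: measurable_ball.
apply: (@le_trans _ _ (`|a|%:E * (e / (`|a| + 1))%:E)%E).
  by rewrite lee_wpmul2l.
by rewrite -EFinM lee_fin.
Qed.

(** The diagonal argument, that is, the lower semicontinuity of the total
    variation for convergence in L^1 on balls. *)
Lemma approximable_limit m u c : measurable_fun [set: borel X] u ->
  (forall e : R, 0 < e -> exists v, [/\ measurable_fun [set: borel X] v,
    approximable m v (c + e) &
    (\int[m]_(x in ball (point : X) e^-1) `|v x - u x|%:E <= e%:E)%E]) ->
  approximable m u c.
Proof.
move=> mu_ H e e0; apply: approximates_larger_ball => //.
have e20 : 0 < e / 2 by rewrite divr_gt0.
exists (e / 2); first by rewrite e20/=; lra.
have [v [mv vc vu]] := H _ e20.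
have [g [lipg ig sg gv]] := vc _ e20; have mg := measurable_loc_lipT lipg.
exists g; split => //.
  by apply: (le_trans sg); rewrite lee_fin; lra.
apply: (@le_trans _ _ (\int[m]_(x in ball (point : X) (e / 2)^-1)
    (`|g x - v x|%:E + `|v x - u x|%:E))%E).
  apply: ge0_le_integral => //; try exact: measurable_ball.
  - exact: measurable_normrB.
  - by apply: emeasurable_funD; exact: measurable_normrB.
  - move=> x _; rewrite -EFinD lee_fin.
    have -> : g x - u x = (g x - v x) + (v x - u x) by lra.
    exact: ler_normD.
rewrite ge0_integralD//; try exact: measurable_normrB; last exact: measurable_ball.
apply: (le_trans (leeD gv vu)); rewrite -EFinD lee_fin; lra.
Qed.

Lemma approximable_weaken m u c d : c <= d -> approximable m u c ->
  approximable m u d.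
Proof.
move=> cd uc e e0; have [g [lipg ig sg gu]] := uc e e0; exists g; split => //.
by apply: (le_trans sg); rewrite lee_fin lerD2r.
Qed.

Lemma approximable0 m : approximable m (fun=> 0) 0.
Proof.
move=> e e0; exists (fun=> 0); split.
- move=> x _; exists setT; first exact: filterT.
  by exists 0 => y z _ _; rewrite subrr normr0 mul0r.
- by move=> r; apply: integrable0; exact: measurable_ball.
- rewrite add0r integral0_eq ?lee_fin ?(ltW e0)// => x _.
  by apply: (@slope_locally_constant _ _ _ _ 1).
- by rewrite integral0_eq ?lee_fin ?(ltW e0)// => x _; rewrite subrr normr0.
Qed.

Lemma approximable_sum m N (u : nat -> X -> R) (c : nat -> R) :
  (forall i, (i < N)%N -> measurable_fun [set: borel X] (u i)) ->
  (forall i, (i < N)%N -> approximable m (u i) (c i)) ->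
  approximable m (fun x => \sum_(i < N) u i x) (\sum_(i < N) c i).
Proof.
elim: N => [|N IH] mu_ uc.
  by under eq_fun do rewrite big_ord0; rewrite big_ord0; exact: approximable0.
rewrite big_ord_recr /=.
have -> : (fun x => \sum_(i < N.+1) u i x) =
    (fun x => \sum_(i < N) u i x + u N x).
  by apply/funext => x; rewrite big_ord_recr.
apply: approximable_add.
- by apply: measurable_sum => i; apply: mu_; rewrite ltnS ltnW.
- exact: mu_.
- by apply: IH => i iN; [apply: mu_|apply: uc]; rewrite ltnS ltnW.
- exact: uc.
Qed.

End approximable.

(** * Indicators are approximable *)

Section approximable_indicator.
Context {R : realType} {X : completeMetricType R}.
Implicit Types (m : {measure set (borel X) -> \bar R}) (f g u v : X -> R).

(** The balls with centre in a countable dense set and radius 1 / (k + 1) are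
    countably many, and every neighbourhood of [x] contains one of them that
    contains [x]; heredity of [P] keeps those that matter. *)
Lemma lindelof_hereditary (P : set X -> Prop) : separable X ->
  (forall U V, open U -> open V -> U `<=` V -> P V -> P U) ->
  (forall x, exists U, [/\ open U, U x & P U]) ->
  exists W : nat -> set X, (forall j, open (W j) /\ P (W j)) /\
    \bigcup_j W j = [set: X].
Proof.
move=> [S cS dS] hP PU.
have P0 : P set0.
  have [U [oU _ PUU]] := PU (point : X); apply: hP PUU => //; exact: open0.
have /countable_injP[code codeI] : countable (S `*` [set: nat]).
  by apply: countableX => //; exact: countableP.
pose good (p : X * nat) := P (ball p.1 p.2.+1%:R^-1).
(* The union has at most one member: it is the good ball with code [j], or
   empty when there is none. *)
pose W j := \bigcup_(p in [set p | [/\ S p.1, good p & code p = j]])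
  ball p.1 p.2.+1%:R^-1.
exists W; split.
  move=> j; have [[p [Sp gp pj]]|noP] :=
      pselect (exists p, [/\ S p.1, good p & code p = j]).
    have -> : W j = ball p.1 p.2.+1%:R^-1.
      apply/seteqP; split => x; last by move=> px; exists p.
      move=> [q [Sq gq qj]]; have -> // : q = p.
      by apply: codeI; rewrite ?inE//= pj qj.
    by split=> //; exact: open_metric_ball.
  have -> : W j = set0.
    by apply/seteqP; split => // x [q qj _]; apply: noP; exists q.
  by split => //; exact: open0.
apply/seteqP; split => // x _; have [U [oU Ux PUU]] := PU x.
have /nbhs_ballP[r /= r0 rU] : nbhs x U by exact: open_nbhs_nbhs.
have r20 : 0 < r / 2 by rewrite divr_gt0.
have [k kr] := exists_invn_lt r20.
have k0 : 0 < k.+1%:R^-1 :> R by rewrite invr_gt0.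
have [y [xy Sy]] : ball x k.+1%:R^-1 `&` S !=set0.
  by apply: dS; [exists x; exact: ballxx|exact: open_metric_ball].
exists (code (y, k)) => //; exists (y, k); last exact: ball_sym.
split => //; rewrite /good /=; apply: hP PUU => //; first exact: open_metric_ball.
apply: subset_trans rU => z; move: xy; rewrite !ball_mdist => xy yz.
by apply: (le_lt_trans (metric_triangle x y z)); rewrite (splitr r) ltrD// (lt_trans _ kr).
Qed.

Lemma ge0_integral_setU_le m (A B : set (borel X)) (h : X -> \bar R) :
  measurable A -> measurable B -> measurable_fun [set: borel X] h ->
  (forall x, 0 <= h x)%E ->
  (\int[m]_(x in A `|` B) h x <=
   \int[m]_(x in A) h x + \int[m]_(x in B) h x)%E.
Proof.
move=> mA mB mh h0.
rewrite -(setDUK (@subsetUl _ A B)) setDUl setDv set0U.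
rewrite ge0_integral_setU//=.
- rewrite leeD2l//; apply: ge0_subset_integral => //; first exact: measurableD.
  exact: measurable_funTS.
- exact: measurableD.
- exact: measurable_funTS.
- by apply/disj_setPS => x [Ax [_]].
Qed.

(** Truncation to [0, 1] does not increase slopes and bounds the difference
    with the indicator by 1.  Countably many of the neighbourhoods of L^1_loc
    convergence cover [X], and finitely many of them cover a given ball up to a
    set of small measure, so the truncated functions converge on the ball. *)
Lemma approximable_indic m (F : set (borel X)) c : separable X ->
  finite_on_bounded m -> measurable F ->
  (total_variation_open m \1_F [set: X] <= c%:E)%E -> approximable m \1_F c.
Proof.
move=> sepX fm mF TVc e e0.
have m1 : measurable_fun [set: borel X] (\1_F : X -> R) by exact: measurable_indic.
have /total_variation_open_lt[f_ [lipf cvgf fc]] :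
    (total_variation_open m \1_F [set: X] < (c + e)%:E)%E.
  by apply: (le_lt_trans TVc); rewrite lte_fin ltrDl.
have mf n := measurable_loc_lipT (lipf n).
pose null (U : set X) := forall e : R, 0 < e -> exists N, forall n, (N <= n)%N ->
  (\int[m]_(x in U) `|f_ n x - \1_F x|%:E <= e%:E)%E.
have hnull (U V : set (borel X)) : measurable U -> measurable V -> U `<=` V ->
    null V -> null U.
  move=> mU mV UV nV d d0; have [N nN] := nV d d0; exists N => n Nn.
  apply: le_trans (nN n Nn); apply: ge0_subset_integral => //.
  exact: measurable_normrB.
have [W [oW WT]] : exists W : nat -> set X, (forall j, open (W j) /\ null (W j)) /\
    \bigcup_j W j = [set: X].
  apply: lindelof_hereditary => // [U V oU oV|x].
    by apply: hnull; exact: open_borel.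
  have [U [oU Ux _ _ cvgU]] := cvgf x; exists U; split => // d d0.
  rewrite setIT in cvgU.
  by have /ge0_cvg0P-/(_ (fun=> integral_normr_ge0 _ _ _)) := cvgU; apply.
have mW j : measurable (W j : set (borel X)) by apply: open_borel; exact: (oW j).1.
pose V J := \big[setU/set0]_(j < J) W j.
have mV J : measurable (V J : set (borel X)) by exact: bigsetU_measurable.
have nullV J : null (V J).
  elim: J => [|J IH].
    by rewrite /V big_ord0 => d d0; exists 0%N => n _; rewrite integral_set0 lee_fin ltW.
  rewrite /V big_ord_recr /= -/(V J) => d d0.
  have d20 : 0 < d / 2 by rewrite divr_gt0.
  have [N1 H1] := IH _ d20; have [N2 H2] := (oW J).2 _ d20.
  exists (maxn N1 N2) => n; rewrite geq_max => /andP[/H1 {}H1 /H2 {}H2].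
  apply: (le_trans (ge0_integral_setU_le _ _ _ _ _)) => //.
    exact: measurable_normrB.
  by apply: (le_trans (leeD H1 H2)); rewrite -EFinD lee_fin; lra.
pose B := ball (point : X) e^-1; have mB : measurable (B : set (borel X)).
  exact: measurable_ball.
have e20 : 0 < e / 2 by rewrite divr_gt0.
have [J VJ] : exists J, (m (B `\` V J) <= (e / 2)%:E)%E.
  have cap : \bigcap_J (B `\` V J) = set0.
    apply/seteqP; split => // x BV.
    have [j _ Wjx] : (\bigcup_j W j) x by rewrite WT.
    have [_] := BV j.+1 I; apply; rewrite /V -bigcup_mkord; exists j => //=.
  have : (m \o (fun J => B `\` V J)) J @[J --> \oo] --> m (\bigcap_J (B `\` V J)).
    apply: nonincreasing_cvg_mu => [|J||i j ij].
    - apply: (@le_lt_trans _ _ (m B)); last exact: finite_on_bounded_ball.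
      apply: le_measure; rewrite ?inE; [exact: measurableD|exact: mB|].
      by move=> x [].
    - exact: measurableD.
    - by rewrite cap.
    apply/subsetPset => x [Bx Vjx]; split => // Vix; apply: Vjx.
    move: Vix; rewrite /V -!bigcup_mkord => -[k /= ki Wk]; exists k => //=.
    exact: leq_trans ij.
  rewrite cap measure0 => /ge0_cvg0P-/(_ (fun=> measure_ge0 _ _))/(_ _ e20)[J H].
  by exists J; exact: H.
have [n fn] := nullV J _ e20.
have {}fn := fn n (leqnn n).
have clip01 s t : `|clamp 0 1 s - clamp 0 1 t| <= 1 * `|s - t| :> R.
  by rewrite mul1r; exact: clamp_lipschitz.
have lipg := locally_lipschitz_comp ler01 clip01 (lipf n).
have mg := measurable_loc_lipT lipg.
have g01 x : 0 <= clamp 0 1 (f_ n x) <= 1 by exact: clamp_bounds.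
exists (clamp 0 1 \o f_ n); split => //.
- move=> r; apply: (@integrable_bounded _ _ _ _ _ 1).
  + exact: measurable_ball.
  + exact: finite_on_bounded_ball.
  + exact: measurable_funTS.
  + by move=> x _; have /andP[g0 g1] := g01 x; rewrite /= ger0_norm.
- apply: le_trans (ltW (fc n)); apply: ge0_le_integral => //.
  + by move=> x _; exact: slope_ge0.
  + exact: measurable_slopeT.
  + exact: measurable_slopeT.
  + by move=> x _; have := slope_comp (f_ n) x ler01 clip01; rewrite mul1e.
have mgF (D : set (borel X)) : measurable_fun D (fun x : X => `|(clamp 0 1 \o f_ n) x - \1_F x|%:E).
  exact: measurable_normrB.
rewrite -/B; apply: (@le_trans _ _ (\int[m]_(x in (B `\` V J) `|` V J)
    `|(clamp 0 1 \o f_ n) x - \1_F x|%:E)%E).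
  apply: ge0_subset_integral => //.
    by apply: measurableU => //; exact: measurableD.
  by move=> x Bx; have [Vx|Vx] := pselect (V J x); [right|left].
apply: (le_trans (ge0_integral_setU_le _ _ _ _ _)) => //; first exact: measurableD.
rewrite [e in (_ <= e%:E)%E]splitr EFinD; apply: leeD.
  apply: le_trans VJ; rewrite -[leRHS]mul1e -integral_cst; last exact: measurableD.
  apply: ge0_le_integral => //; first exact: measurableD.
  move=> x _ /=; rewrite lee_fin; have /andP[g0 g1] := g01 x.
  by rewrite ler_norml indicE; case: (_ \in _) => /=; lra.
apply: le_trans fn; apply: ge0_le_integral => //; first exact: measurable_normrB.
move=> x _; rewrite lee_fin.
have cF : clamp 0 1 (\1_F x) = \1_F x :> R.
  by rewrite /clamp indicE; case: (_ \in _) => /=; rewrite ?max_l ?min_l ?min_r//.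
by rewrite -{1}cF; apply: le_trans (clip01 _ _) _; rewrite mul1r.
Qed.

End approximable_indicator.

(** * Cutting a function into layers *)

Section layers.
Context {R : realType} {X : completeMetricType R}.
Implicit Types (mu : {measure set (borel X) -> \bar R}) (A : set X).
Implicit Types (f u : X -> R) (h s t : R).

Definition layer h (i : nat) s : R := clamp 0 h (s - i%:R * h).

Lemma layer_bounds h i s : 0 <= h -> 0 <= layer h i s <= h.
Proof. exact: clamp_bounds. Qed.

Lemma layer_lipschitz h i s t : `|layer h i s - layer h i t| <= 1 * `|s - t|.
Proof.
rewrite mul1r; apply: (le_trans (clamp_lipschitz _ _ _ _)).
by rewrite opprB addrA subrK.
Qed.

Lemma layer_eq0 h i s : 0 <= h -> s <= i%:R * h -> layer h i s = 0.
Proof.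
by move=> h0 si; rewrite /layer /clamp max_r ?subr_le0// min_l.
Qed.

Lemma layer_eq_h h i s : 0 <= h -> i.+1%:R * h <= s -> layer h i s = h.
Proof.
rewrite -natr1 => h0 si; have hs : h <= s - i%:R * h by lra.
by rewrite /layer /clamp max_l ?min_r// (le_trans h0).
Qed.

Lemma sum_layer h N s : 0 <= h ->
  \sum_(i < N) layer h i s = clamp 0 (N%:R * h) s.
Proof.
move=> h0; elim: N => [|N IH].
  rewrite big_ord0 mul0r /clamp min_r// le_max lexx orbT//.
rewrite big_ord_recr/= IH -natr1 /layer /clamp.
have Nh : 0 <= N%:R * h by rewrite mulr_ge0.
have [s0|s0] := leP s 0; have [sN|sN] := leP (s - N%:R * h) 0; rewrite ?minr_l//.
all: rewrite /Num.min; repeat case: ifPn; rewrite -?leNgt => *; try lra.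
Qed.

Lemma measurable_layer h i : measurable_fun [set: R] (layer h i).
Proof.
apply: measurable_minr => //; apply: measurable_maxr => //.
exact: measurable_funB.
Qed.

(** The layers below [s] are full and those above are empty, so that only the
    layer containing [s] contributes to the sum. *)
Lemma layer_quantization h N s (t : nat -> R) : 0 < h ->
  (forall i, 0 < t i < h) ->
  `|\sum_(i < N) (h * ((t i < layer h i s)%R : nat)%:R - layer h i s)| <= h.
Proof.
move=> h0 t0; have hh := ltW h0.
have full n : n%:R * h <= s ->
    \sum_(i < n) (h * ((t i < layer h i s)%R : nat)%:R - layer h i s) = 0.
  elim: n => [|n IH] ns; first by rewrite big_ord0.
  rewrite big_ord_recr/= IH; last by apply: le_trans ns; rewrite ler_pM2r// ler_nat.
  have /andP[_ tn] := t0 n.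
  by rewrite layer_eq_h// tn mulr1 subrr addr0.
elim: N => [|N IH]; first by rewrite big_ord0 normr0.
rewrite big_ord_recr/=; have /andP[tN0 tNh] := t0 N.
have [sN|sN] := leP s (N%:R * h).
  by rewrite layer_eq0// ltNge (ltW tN0)/= mulr0 subr0 addr0.
rewrite full ?(ltW sN)// add0r.
have /andP[l0 lh] := layer_bounds N s hh.
by rewrite ler_norml; case: (t N < _) => /=; lra.
Qed.

(** The closed strips overlap at the multiples of [h], whence 2 instead of 1;
    the induction needs the sharper counts on and above the top boundary. *)
Lemma count_layers h N s : 0 < h ->
  (\sum_(i < N) ((i%:R * h <= s <= i.+1%:R * h)%R : nat) <= 2)%N.
Proof.
move=> h0.
suff [] : [/\ (\sum_(i < N) ((i%:R * h <= s <= i.+1%:R * h)%R : nat) <= 2)%N,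
   ((s = N%:R * h)%R -> \sum_(i < N) ((i%:R * h <= s <= i.+1%:R * h)%R : nat) <= 1)%N &
   ((N%:R * h < s)%R -> \sum_(i < N) ((i%:R * h <= s <= i.+1%:R * h)%R : nat) = 0)%N] by [].
elim: N => [|N [H2 H1 H0]].
  by rewrite big_ord0.
have hN : N%:R * h < N.+1%:R * h by rewrite ltr_pM2r// ltr_nat.
rewrite big_ord_recr/=; split.
- have [sN|sN|sN] := ltgtP s (N%:R * h).
  + by rewrite addn0.
  + by rewrite H0//; case: (s <= _).
  + by apply: (leq_add (H1 sN)); case: (s <= _).
- by move=> sE; rewrite H0 ?sE//; case: (_ && _).
- by move=> Ns; rewrite H0 ?(lt_trans hN)// (leNgt s) Ns andbF.
Qed.

(** At a point where [f] takes a multiple of [h] as value, two consecutive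
    layers can both have the full slope of [f]. *)
Lemma sum_slope_layer A f h N x : open A -> locally_lipschitz_on A f -> A x ->
  0 < h -> (\sum_(i < N) slope (layer h i \o f) x <= 2%:E * slope f x)%E.
Proof.
move=> oA lipf Ax h0; have hh := ltW h0.
apply: (@le_trans _ _ (\sum_(i < N) (slope f x *
    ((i%:R * h <= f x <= i.+1%:R * h)%R : nat)%:R%:E))%E).
  apply: lee_sum => i _.
  have [/andP[ia ib]|] := boolP (_ <= _ <= _).
    rewrite mule1; have := slope_comp f x ler01 (layer_lipschitz h i).
    by rewrite mul1e.
  rewrite negb_and -!ltNge mule0 => /orP fx.
  have [e e0 flat] : exists2 e : R, 0 < e & forall s, `|s - f x| < e ->
      layer h i s = layer h i (f x).
    case: fx => fx; [exists (i%:R * h - f x)|exists (f x - i.+1%:R * h)].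
    - by lra.
    - by move=> s; rewrite ltr_norml => /andP[h1 h2]; rewrite !layer_eq0//; lra.
    - by lra.
    - by move=> s; rewrite ltr_norml => /andP[h1 h2]; rewrite !layer_eq_h//; lra.
  by rewrite (slope_comp_flat oA lipf Ax e0 flat).
rewrite -ge0_sume_distrr; last by move=> i _; rewrite lee_fin.
rewrite muleC lee_wpmul2r ?slope_ge0// sumEFin lee_fin -natr_sum ler_nat.
exact: count_layers.
Qed.

Lemma layer0 h i : 0 <= h -> layer h i 0 = 0.
Proof. by move=> h0; rewrite layer_eq0// mulr_ge0. Qed.

Lemma integrable_comp_lipschitz mu (D : set (borel X)) u (phi : R -> R) :
  measurable D -> measurable_fun [set: R] phi ->
  (forall s t, `|phi s - phi t| <= 1 * `|s - t|) -> phi 0 = 0 ->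
  mu.-integrable D (EFin \o u) -> mu.-integrable D (EFin \o (phi \o u)).
Proof.
move=> mD mphi lip phi0 iu.
have mu_ : measurable_fun D u.
  by apply/measurable_EFinP; exact: measurable_int iu.
apply: le_integrable iu => //.
  by apply/measurable_EFinP; exact: measurableT_comp.
by move=> y _ /=; rewrite lee_fin; have := lip (u y) 0; rewrite phi0 !subr0 mul1r.
Qed.

Lemma sum_integral_layer mu (D : set (borel X)) u h N : measurable D ->
  measurable_fun [set: borel X] u -> 0 <= h ->
  (\sum_(i < N) \int[mu]_(x in D) `|(layer h i \o u) x|%:E <=
   \int[mu]_(x in D) `|u x|%:E)%E.
Proof.
move=> mD mu_ h0.
have mul (i : nat) : measurable_fun D (fun x => `|(layer h i \o u) x|%:E).
  apply/measurable_EFinP; apply: measurable_funTS; apply: measurableT_comp => //.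
  by apply: measurableT_comp => //; exact: measurable_layer.
rewrite -(@ge0_integral_sum _ _ _ mu D mD _
  (fun (i : 'I_N) x => `|(layer h i \o u) x|%:E)); first last.
- by move=> i x _; rewrite lee_fin.
- by move=> i; exact: mul.
apply: ge0_le_integral => //.
- by move=> x _; exact: sume_ge0.
- by apply: emeasurable_sum => i; exact: mul.
- by apply/measurable_EFinP; apply: measurable_funTS; exact: measurableT_comp.
move=> x _; rewrite sumEFin lee_fin.
rewrite (eq_bigr (fun i : 'I_N => layer h i (u x))); last first.
  by move=> i _; have /andP[l0 _] := layer_bounds i (u x) h0; rewrite ger0_norm.
rewrite sum_layer// /clamp ge_min; apply/orP.
have [u0|u0] := leP (u x) 0; last by left; exact: ler_norm.
by left; exact: normr_ge0.
Qed.

Lemma L1loc_cvg_comp mu A (f_ : (X -> R)^nat) u (phi : R -> R) : open A ->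
  measurable_fun [set: R] phi -> (forall s t, `|phi s - phi t| <= 1 * `|s - t|) ->
  phi 0 = 0 -> L1loc_cvg mu A f_ u ->
  L1loc_cvg mu A (fun n => phi \o f_ n) (phi \o u).
Proof.
move=> oA mphi lip phi0 cvgf x; have [U [oU Ux intf intu cvgU]] := cvgf x.
have mUA : measurable (U `&` A : set (borel X)).
  by apply: open_borel; exact: openI.
have int_comp g : mu.-integrable (U `&` A) (EFin \o g) ->
    mu.-integrable (U `&` A) (EFin \o (phi \o g)).
  exact: integrable_comp_lipschitz.
exists U; split => //; first by move=> n; exact: int_comp.
  exact: int_comp.
apply: (squeeze_cvge _ (cvg_cst 0%E) cvgU); apply: nearW => n.
rewrite integral_normr_ge0 /=.
have mf g : mu.-integrable (U `&` A) (EFin \o g) ->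
    measurable_fun (U `&` A : set (borel X)) g.
  by move=> ig; apply/measurable_EFinP; exact: measurable_int ig.
apply: ge0_le_integral => //.
- apply/measurable_EFinP; apply: measurableT_comp => //.
  by apply: measurable_funB; apply: mf; exact: int_comp.
- apply/measurable_EFinP; apply: measurableT_comp => //.
  by apply: measurable_funB; exact: mf.
- by move=> y _; rewrite lee_fin; have := lip (f_ n y) (u y); rewrite mul1r.
Qed.

Lemma total_variation_open_comp mu A u (phi : R -> R) : open A ->
  measurable_fun [set: R] phi -> (forall s t, `|phi s - phi t| <= 1 * `|s - t|) ->
  phi 0 = 0 ->
  (total_variation_open mu (phi \o u) A <= total_variation_open mu u A)%E.
Proof.
move=> oA mphi lip phi0; apply: le_ereal_inf_tmp => _ [f_ [lipf cvgf] <-].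
apply: (@le_trans _ _ (limn_einf (fun n => \int[mu]_(x in A) slope (phi \o f_ n) x)%E)).
  apply: ereal_inf_lbound; exists (fun n => phi \o f_ n) => //; split.
    by move=> n; exact: (locally_lipschitz_comp ler01 lip).
  exact: L1loc_cvg_comp.
apply: le_limn_einf => n; apply: ge0_le_integral.
- exact: open_borel.
- by move=> x _; exact: slope_ge0.
- by apply: measurable_slope => //; exact: (locally_lipschitz_comp ler01 lip).
- exact: measurable_slope.
- by move=> x _; have := slope_comp (f_ n) x ler01 lip; rewrite mul1e.
Qed.

(** The same approximating sequence serves for all layers, so that the sum of
    the slopes is compared pointwise with one slope. *)
Lemma sum_total_variation_layer mu A u h N (c : R) : open A -> 0 < h ->
  (total_variation_open mu u A < c%:E)%E ->
  (\sum_(i < N) total_variation_open mu (layer h i \o u) A <= (2 * c)%:E)%E.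
Proof.
move=> oA h0 /total_variation_open_lt[f_ [lipf cvgf fc]].
have mA : measurable (A : set (borel X)) by exact: open_borel.
have lipl i n : locally_lipschitz_on A (layer h i \o f_ n).
  exact: (locally_lipschitz_comp ler01 (layer_lipschitz h i)).
apply: (@le_trans _ _ (\sum_(i < N) limn_einf (fun n =>
    \int[mu]_(x in A) slope (layer h i \o f_ n) x))%E).
  apply: lee_sum => i _; apply: ereal_inf_lbound.
  exists (fun n => layer h i \o f_ n) => //; split => //.
  by apply: L1loc_cvg_comp => //; 
    [exact: measurable_layer|exact: layer_lipschitz|rewrite layer0// ltW].
apply: (le_trans (@limn_einf_sum_le _ N (fun (i : nat) n =>
    \int[mu]_(x in A) slope (layer h i \o f_ n) x)%E _)).
  by move=> i n; apply: integral_ge0 => x _; exact: slope_ge0.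
apply: limn_einf_le => n; exists n => //.
rewrite -(@ge0_integral_sum _ _ _ mu A mA _ (fun (i : 'I_N) => slope (layer h i \o f_ n))); first last.
- by move=> i x _; exact: slope_ge0.
- by move=> i; exact: measurable_slope.
apply: (@le_trans _ _ (\int[mu]_(x in A) (2%:E * slope (f_ n) x))%E).
  apply: ge0_le_integral => //.
  - by move=> x _; apply: sume_ge0 => i _; exact: slope_ge0.
  - by apply: emeasurable_sum => i; exact: measurable_slope.
  - by apply: measurable_funeM; exact: measurable_slope.
  - by move=> x Ax; exact: (sum_slope_layer _ oA (lipf n) Ax h0).
rewrite ge0_integralZl//; last 2 first.
- exact: measurable_slope.
- by move=> x _; exact: slope_ge0.
by rewrite EFinM lee_pmul2l// ltW.
Qed.

End layers.

(** * Convergent selections from decreasing convex sets *)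

Section convex_selection.
Context d (T : measurableType d) {R : realType} (mu : {measure set T -> \bar R}).
Implicit Types (w v : T -> R).
Local Open Scope ereal_scope.

Let sq w : \bar R := \int[mu]_x ((w x) ^+ 2)%:E.

Let sq_ge0 w : 0 <= sq w.
Proof. by apply: integral_ge0 => x _; rewrite lee_fin sqr_ge0. Qed.

Let measurable_sq w : measurable_fun setT w ->
  measurable_fun setT (fun x => ((w x) ^+ 2)%:E).
Proof. by move=> mw; apply/measurable_EFinP; exact: measurable_funX. Qed.

(** The squared norm of half the difference measures how far the squared norm of
    the midpoint falls below the average. *)
Let parallelogram w v : measurable_fun setT w -> measurable_fun setT v ->
  (4^-1)%:E * sq (fun x => w x - v x)%R + sq (fun x => 2^-1 * (w x + v x))%R =
  (2^-1)%:E * (sq w + sq v).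
Proof.
move=> mw mv; have mB : measurable_fun setT (fun x => w x - v x)%R.
  exact: measurable_funB.
have mD : measurable_fun setT (fun x => 2^-1 * (w x + v x))%R.
  by apply: measurable_funM => //; exact: measurable_funD.
rewrite /sq -ge0_integralZl//; last 2 first.
- exact: measurable_sq.
- by move=> x _; rewrite lee_fin sqr_ge0.
rewrite -ge0_integralD//; first last.
- exact: measurable_sq.
- by move=> x _; rewrite lee_fin sqr_ge0.
- by apply: measurable_funeM; exact: measurable_sq.
- by move=> x _; rewrite -EFinM lee_fin mulr_ge0// sqr_ge0.
rewrite -[X in _ = _ * X]ge0_integralD//; first last.
- exact: measurable_sq.
- by move=> x _; rewrite lee_fin sqr_ge0.
- exact: measurable_sq.
- by move=> x _; rewrite lee_fin sqr_ge0.
rewrite -ge0_integralZl//; last 2 first.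
- by apply: emeasurable_funD; exact: measurable_sq.
- by move=> x _; rewrite -EFinD lee_fin addr_ge0// sqr_ge0.
apply: eq_integral => x _; rewrite -!(EFinM, EFinD); congr EFin.
rewrite !expr2; lra.
Qed.

(** The sequence [a n - 2 ^ (1 - n)] is eventually nondecreasing, and bounded. *)
Let cvg_of_small_steps (a : R^nat) :
  (exists N, forall n, (N <= n)%N -> (`|a n - a n.+1| <= 2^-1 ^+ n)%R) ->
  (forall n, a n <= 1)%R -> cvgn a.
Proof.
move=> [N aN] a1.
pose b n := (a (n + N)%N - 2 * 2^-1 ^+ (n + N))%R.
have cb : cvgn b.
  apply: nondecreasing_is_cvgn.
    apply/nondecreasing_seqP => n; rewrite /b addSn exprS.
    by have := aN (n + N)%N (leq_addl _ _); rewrite ler_norml => /andP[]; lra.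
  exists 1%R => _ [n _ <-]; rewrite /b.
  have := a1 (n + N)%N; have : (0 <= 2^-1 ^+ (n + N) :> R)%R by rewrite exprn_ge0.
  lra.
have ce : (fun n => 2 * 2^-1 ^+ (n + N) : R)%R @ \oo --> (2 * 0 : R)%R.
  apply: cvgMl_tmp; rewrite (cvg_shiftn N (fun n => 2^-1 ^+ n : R)%R).
  by apply: cvg_expr; rewrite ger0_norm//; lra.
have : cvgn (fun n => a (n + N)%N).
  have -> : (fun n => a (n + N)%N) = (fun n => b n + 2 * 2^-1 ^+ (n + N))%R.
    by apply/funext => n; rewrite /b subrK.
  by apply: is_cvgD => //; apply/cvg_ex; eexists; exact: ce.
by move=> /cvg_ex[l al]; apply/cvg_ex; exists l; rewrite -(cvg_shiftn N).
Qed.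

(** The infimum of the squared L^2 norm over [K n] increases with [n] to a limit
    [s <= c].  Elements of [K n] whose squared norm exceeds [s] by little have
    midpoints in some [K k] where the squared norm is not far below [s], so by
    the parallelogram law they are close to each other in L^2. *)
Lemma convex_selection (K : nat -> set (T -> R)) (c : R) :
  (forall n w, K n w -> measurable_fun setT w) ->
  (forall n w x, K n w -> (0 <= w x <= 1)%R) ->
  (forall n w, K n w -> \int[mu]_x (w x)%:E <= c%:E) ->
  (forall n, K n.+1 `<=` K n) ->
  (forall n w v, K n w -> K n v -> K n (fun x => 2^-1 * (w x + v x))%R) ->
  (forall n, exists w, K n w) ->
  exists (w_ : (T -> R)^nat) w, [/\ forall n, K n (w_ n), measurable_fun setT w,
    forall x, (0 <= w x <= 1)%R &
    {ae mu, forall x, (w_ ^~ x) @ \oo --> w x}].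
Proof.
move=> mK K01 Kc Kdec Kmid Kne.
have Kle i j : (i <= j)%N -> K j `<=` K i.
  move=> /subnK <-; elim: (j - i)%N => [//|k IH].
  exact: subset_trans (Kdec _) IH.
have sqc n w : K n w -> sq w <= c%:E.
  move=> Kw; apply: le_trans (Kc n w Kw); apply: ge0_le_integral => //.
  - by move=> x _; rewrite lee_fin sqr_ge0.
  - exact: measurable_sq (mK _ _ Kw).
  - by apply/measurable_EFinP; exact: mK Kw.
  - by move=> x _; have /andP[w0 w1] := K01 n w x Kw; rewrite lee_fin expr2; nra.
(* The supremum of the lower bounds of [sq] on the sets [K k] is the limit of
   the infima.  With [eps n] equal to 1 / 8 ^ n the steps are bounded by 8 / 8 ^ n
   in squared norm, hence exceed 1 / 2 ^ n on a set of measure 8 / 2 ^ n at most,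
   and Borel-Cantelli applies. *)
pose S : set R := [set r | exists k, forall v, K k v -> r%:E <= sq v].
have S0 : S 0%R by exists 0%N => v _; exact: sq_ge0.
have supS : has_sup S.
  split; first by exists 0%R.
  exists c => r [k rk]; have [w Kw] := Kne k.
  by rewrite -lee_fin; apply: le_trans (rk _ Kw) (sqc k w Kw).
pose s := sup S; pose eps n : R := ((2^-1 ^+ n) ^+ 3)%R.
have y0 n : (0 < 2^-1 ^+ n :> R)%R by rewrite exprn_gt0.
have e0 n : (0 < eps n)%R by rewrite exprn_gt0.
have /choice[w_ wP] : forall n, exists w, exists k, [/\ (n <= k)%N, K k w,
    sq w <= (s + eps n)%:E & forall v, K k v -> (s - eps n)%:E <= sq v].
  move=> n; have [r [k rk] sr] := sup_adherent (e0 n) supS.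
  have : ~ S (s + eps n)%R.
    by move=> /(ub_le_sup supS.2); rewrite -/s leNgt ltrDl e0.
  move=> /forallNP/(_ (maxn n k))/existsNP[w /not_implyP[Kw /negP]].
  rewrite -ltNge => wl; exists w, (maxn n k); split.
  - exact: leq_maxl.
  - by [].
  - exact: ltW.
  - move=> v Kv; apply: le_trans (rk v (Kle _ _ (leq_maxr n k) _ Kv)).
    by rewrite lee_fin ltW.
have wK n : K n (w_ n) by have [k [nk Kw _ _]] := wP n; exact: Kle Kw.
have mw n := mK _ _ (wK n).
have step n : sq (fun x => w_ n x - w_ n.+1 x)%R <= (8 * eps n)%:E.
  have [k [nk Kw wu wl]] := wP n; have [k' [nk' Kw' wu' wl']] := wP n.+1.
  have en : (eps n.+1 <= eps n)%R.
    rewrite /eps; apply: lerXn2r; rewrite ?nnegrE.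
    - exact: ltW (y0 _).
    - exact: ltW (y0 _).
    - by rewrite exprS; have := y0 n; lra.
  have mid : (s - eps n)%:E <= sq (fun x => 2^-1 * (w_ n x + w_ n.+1 x))%R.
    have [kk'|k'k] := leqP k k'.
      by apply: wl; apply: Kmid => //; exact: Kle Kw'.
    apply: (@le_trans _ _ (s - eps n.+1)%:E); first by rewrite lee_fin; lra.
    by apply: wl'; apply: Kmid => //; apply: Kle Kw; exact: ltnW.
  have := parallelogram (mw n) (mw n.+1).
  have D_fin : sq (fun x => w_ n x - w_ n.+1 x)%R \is a fin_num.
    have lt : (4^-1)%:E * sq (fun x => w_ n x - w_ n.+1 x)%R < +oo.
      apply: (@le_lt_trans _ _ ((2^-1)%:E * (c + c)%:E)); last by rewrite -EFinM ltry.
      apply: (@le_trans _ _ ((2^-1)%:E * (sq (w_ n) + sq (w_ n.+1)))).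
        by rewrite -parallelogram// leeDl.
      rewrite lee_wpmul2l ?lee_fin//.
      by rewrite EFinD; apply: leeD; exact: sqc (wK _).
    rewrite ge0_fin_numE// ltNge leye_eq; apply/eqP => Dy; move: lt.
    by rewrite Dy gt0_muley ?lte_fin.
  have fin v i : sq v <= i%:E -> sq v \is a fin_num.
    by move=> vi; rewrite ge0_fin_numE// (le_lt_trans vi)// ltry.
  have f1 := fin _ _ wu; have f2 := fin _ _ wu'.
  have f3 : sq (fun x => 2^-1 * (w_ n x + w_ n.+1 x))%R \is a fin_num.
    by apply: (fin _ c); apply: (sqc n); apply: Kmid => //; exact: (Kdec n).
  move: mid wu wu'; rewrite -(fineK D_fin) -(fineK f1) -(fineK f2) -(fineK f3).
  rewrite -!(EFinM, EFinD) !lee_fin => h1 h2 h3 [h4]; lra.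
pose A n := [set x | (2^-1 ^+ n < `|w_ n x - w_ n.+1 x|)%R].
have mdiff n : measurable_fun setT (fun x => w_ n x - w_ n.+1 x)%R.
  exact: measurable_funB.
have mA n : measurable (A n).
  have -> : A n = ~` (setT `&` [set x | (`|w_ n x - w_ n.+1 x| <= 2^-1 ^+ n)%R]).
    apply/seteqP; split => x; rewrite /A /= ltNge; first by move=> /negP H [_].
    by move=> H; apply/negP => H'; exact: H.
  by apply: measurableC; apply: measurable_fun_le => //; exact: measurableT_comp.
have A_small n : mu (A n) <= (8 * 2^-1 ^+ n)%:E.
  have yy : (0 < (2^-1 ^+ n) ^+ 2 :> R)%R by rewrite exprn_gt0.
  rewrite -(lee_pmul2l _ (x := ((2^-1 ^+ n) ^+ 2)%:E)) ?lte_fin//.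
  apply: (@le_trans _ _ (\int[mu]_(x in A n) ((w_ n x - w_ n.+1 x) ^+ 2)%:E)).
    rewrite -integral_cst//; apply: ge0_le_integral => //.
    - by move=> x _; rewrite lee_fin ltW.
    - by apply: measurable_funTS; exact: measurable_sq.
    move=> x Ax; rewrite /= lee_fin -[leRHS]real_normK ?num_real//.
    apply: lerXn2r; rewrite ?nnegrE//.
    exact: ltW.
  apply: (@le_trans _ _ (sq (fun x => w_ n x - w_ n.+1 x)%R)).
    apply: ge0_subset_integral => //; first exact: measurable_sq.
    by move=> x _; rewrite lee_fin sqr_ge0.
  apply: (le_trans (step n)); rewrite -EFinM lee_fin /eps.
  by rewrite [X in (_ * X <= _)%R]exprSr; lra.
have AS : mu (lim_sup_set A) = 0.
  apply: lim_sup_set_cvg0 => //.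
  apply: (@le_lt_trans _ _ (\sum_(0 <= n <oo) ((16 / (2 ^ n.+1)%:R)%:E : \bar R))).
    apply: lee_nneseries => [n _ _|n _]; first exact: measure_ge0.
    apply: le_trans (A_small n) _; rewrite lee_fin natrX exprS exprVn invfM.
    lra.
  by apply: (le_lt_trans (epsilon_trick0 _ _)) => //; exact: ltry.
pose w x := fine (limn_esup (fun n => (w_ n x)%:E)).
have w01 x : 0 <= limn_esup (fun n => (w_ n x)%:E) <= 1.
  have wb n : 0 <= (w_ n x)%:E <= 1 by rewrite !lee_fin; exact: K01 (wK n).
  rewrite limn_esup_lim; apply/andP; split.
    apply: lime_ge; first exact: is_cvg_esups.
    apply: nearW => n; apply: (@le_trans _ _ (w_ n x)%:E).
      by have /andP[] := wb n.
    by apply: ereal_sup_ubound; exists n => /=.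
  apply: lime_le; first exact: is_cvg_esups.
  apply: nearW => n; apply: ub_ereal_sup => _ [k _ <-].
  by have /andP[] := wb k.
exists w_, w; split => //.
- apply: measurableT_comp => //; apply: measurable_fun_limn_esup => n.
  exact/measurable_EFinP.
- move=> x; have /andP[l0 l1] := w01 x.
  have lf : limn_esup (fun n => (w_ n x)%:E) \is a fin_num.
    by rewrite ge0_fin_numE// (le_lt_trans l1)// ltry.
  by rewrite -!lee_fin fineK// l0.
exists (lim_sup_set A); split => //.
  by apply: bigcap_measurable => // n _; exact: bigcup_measurable.
move=> x /= nx; apply: contrapT => xA; apply: nx.
have cw : cvgn (w_ ^~ x).
  apply: cvg_of_small_steps; last by move=> n; have /andP[] := K01 _ _ x (wK n).
  move: xA => /existsNP[N /not_implyP[_ H]]; exists N => n Nn.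
  by rewrite leNgt; apply/negP => An; apply: H; exists n.
have /cvg_ex[l wl] := cw.
suff -> : w x = l by [].
rewrite /w; have -> : limn_esup (fun n => (w_ n x)%:E) = l%:E; last by [].
by apply: (cvg_limn_einf_sup _).2; apply: cvg_EFin => //; exact: nearW.
Qed.
End convex_selection.

(** * Extending functions by extending their level sets *)

Lemma ae_imply d (T : measurableType d) {R : realType}
    (mu : {measure set T -> \bar R}) (P Q : T -> Prop) :
  {ae mu, forall x, P x} -> (forall x, P x -> Q x) -> {ae mu, forall x, Q x}.
Proof.
by move=> aeP PQ; apply: (@filterS _ _ (ae_filter_ringOfSetsType mu) _ _ PQ aeP).
Qed.

Lemma ae_imply2 d (T : measurableType d) {R : realType}
    (mu : {measure set T -> \bar R}) (P Q S : T -> Prop) :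
  {ae mu, forall x, P x} -> {ae mu, forall x, Q x} ->
  (forall x, P x -> Q x -> S x) -> {ae mu, forall x, S x}.
Proof.
move=> aeP aeQ PQS.
exact: (@filterS2 _ _ (ae_filter_ringOfSetsType mu) _ _ _ PQS aeP aeQ).
Qed.

Section extension_of_functions.
Context {R : realType} {X : completeMetricType R}.
Context (m : {measure set (borel X) -> \bar R}) (Omega : set X).
Context (sepX : separable X) (finm : finite_on_bounded m) (oOmega : open Omega).
Context (C : R) (C0 : 0 < C).

Let mO := open_borel oOmega.
Let mu : {measure set (borel X) -> \bar R} := mrestr m mO.

Context (extP : forall E : set (borel X),
    measurable E -> E `<=` Omega -> (perimeter_in m mO E < +oo)%E ->
    exists F : set (borel X), [/\ measurable F,
      (m F + perimeter m F [set: X] <= C%:E * (m E + perimeter_in m mO E))%E &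
      m (E `+` (F `&` Omega)) = 0%E]).

Let fmu : finite_on_bounded mu.
Proof. exact: finite_on_bounded_mrestr. Qed.

(** [coarea_level] in Omega, followed by the extension of the superlevel set. *)
Lemma level_set_extension (u : X -> R) (h c : R) :
  mu.-integrable [set: borel X] (EFin \o u) -> 0 < h ->
  (\int[mu]_(x in Omega) `|u x|%:E + total_variation_open mu u Omega < c%:E)%E ->
  exists t (F : set X), [/\ 0 < t < h, measurable (F : set (borel X)),
    (h%:E * (m F + total_variation_open m \1_F [set: X]) <= (C * c)%:E)%E &
    {ae m, forall x, Omega x -> \1_F x = ((t < u x)%R : nat)%:R :> R}].
Proof.
move=> iu h0 uc; have mu_ : measurable_fun [set: borel X] u.
  by apply/measurable_EFinP; exact: measurable_int iu.
have [t [t0 th tc]] := coarea_level fmu oOmega iu h0 uc.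
set E := Omega `&` [set x | t < u x] in tc.
have mE : measurable (E : set (borel X)).
  by apply: measurableI => //; exact: measurable_superlevel.
have EO : E `<=` Omega by move=> x [].
have muE : mu E = m E by rewrite /mu /= /mrestr; congr (m _); exact/setIidPl.
have TVE : total_variation_open mu \1_E Omega = perimeter_in m mO E.
  by rewrite /perimeter_in /total_variation_in total_variation_openE.
rewrite muE TVE in tc.
have P0 : (0 <= perimeter_in m mO E)%E by rewrite -TVE; exact: total_variation_open_ge0.
have Pfin : (perimeter_in m mO E < +oo)%E.
  rewrite ltNge leye_eq; apply/eqP => Py; move: tc.
  by rewrite Py addey ?gt0_muley ?lte_fin// -ltNye// (lt_le_trans _ (measure_ge0 _ _)).
have [F [mF FE FO]] := extP mE EO Pfin.
exists t, F; split => //; first by rewrite t0.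
  rewrite /perimeter total_variation_openE in FE; last exact: openT.
  apply: (@le_trans _ _ (h%:E * (C%:E * (m E + perimeter_in m mO E)))%E).
    by rewrite lee_pmul2l// lte_fin.
  by rewrite muleCA [(C * c)%:E]EFinM lee_pmul2l// lte_fin.
exists (E `+` (F `&` Omega)); split => //.
  by apply: measurableU; apply: measurableD => //; exact: measurableI.
move=> x /= nx; apply: contrapT => xEF; apply: nx => Ox.
rewrite indicE; congr (nat_of_bool _)%:R; apply/idP/idP.
  move=> /set_mem Fx; apply: contrapT => /negP tu; apply: xEF; right.
  by split => // -[_ /= tu']; rewrite tu' in tu.
move=> tu; apply/mem_set; apply: contrapT => Fx; apply: xEF; left.
by split => // -[].
Qed.

(** One level is selected in each of [N.+1] layers of equal height; the weighted
    sum of the indicators of the extended superlevel sets agrees almost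
    everywhere in Omega with the quantization in [layer_quantization]. *)
Lemma quantized_extension (u : X -> R) (c b : R) (N : nat) :
  (forall x, 0 <= u x <= 1) -> mu.-integrable [set: borel X] (EFin \o u) ->
  (total_variation_open mu u Omega < c%:E)%E ->
  (\int[mu]_(x in Omega) `|u x|%:E + (2 * c)%:E < b%:E)%E ->
  exists v : X -> R, [/\ measurable_fun [set: borel X] v, forall x, 0 <= v x <= 1,
    (\int[m]_x (v x)%:E <= (C * b)%:E)%E, approximable m v (C * b) &
    {ae m, forall x, Omega x -> `|v x - u x| <= N.+1%:R^-1}].
Proof.
move=> u01 iu uc ub; pose n := N.+1; pose h : R := n%:R^-1.
have h0 : 0 < h by rewrite invr_gt0.
have hh := ltW h0.
have nh : n%:R * h = 1 by rewrite mulfV// pnatr_eq0.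
have mu_ : measurable_fun [set: borel X] u.
  by apply/measurable_EFinP; exact: measurable_int iu.
pose ul i := layer h i \o u.
have iul i : mu.-integrable [set: borel X] (EFin \o ul i).
  apply: integrable_comp_lipschitz => //; first exact: measurable_layer.
    exact: layer_lipschitz.
  exact: layer0.
pose a i : \bar R := (\int[mu]_(x in Omega) `|ul i x|%:E +
  total_variation_open mu (ul i) Omega)%E.
have a0 i : (0 <= a i)%E.
  by rewrite adde_ge0 ?integral_normr_ge0 ?total_variation_open_ge0.
set I := (\int[mu]_(x in Omega) `|u x|%:E)%E in ub.
have I_fin : I \is a fin_num.
  rewrite ge0_fin_numE ?integral_normr_ge0//.
  rewrite ltNge leye_eq; apply/eqP => Iy; move: ub.
  by rewrite Iy addye// ltNge leey.
have sum_a : (\sum_(i < n) a i <= I + (2 * c)%:E)%E.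
  rewrite big_split/=; apply: leeD; last exact: sum_total_variation_layer.
  exact: sum_integral_layer.
have a_fin i : (i < n)%N -> a i \is a fin_num.
  move=> ilt; rewrite ge0_fin_numE//.
  apply: (@le_lt_trans _ _ (I + (2 * c)%:E)%E); last first.
    by rewrite -(fineK I_fin) -EFinD ltry.
  apply: le_trans sum_a; rewrite (bigD1 (Ordinal ilt))//= leeDl//.
  by apply: sume_ge0 => j _.
(* The slack left by [ub] is shared equally by the layers, since
   [coarea_level] requires a strict bound. *)
pose k := (b - (fine I + 2 * c)) / n%:R.
have k0 : 0 < k.
  by rewrite divr_gt0// subr_gt0 -lte_fin EFinD fineK.
pose ci i := fine (a i) + k.
have sum_ci : \sum_(i < n) ci i <= b.
  rewrite big_split/= sumr_const card_ord -[k *+ n]mulr_natr mulfVK ?pnatr_eq0//.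
  suff : \sum_(i < n) fine (a i) <= fine I + 2 * c by lra.
  rewrite -lee_fin -sumEFin EFinD fineK//.
  rewrite (eq_bigr (fun i : 'I_n => a i))// => i _.
  by rewrite fineK// a_fin.
have /choice[tF tFP] : forall i, exists p : R * set X, 0 < p.1 < h /\ ((i < n)%N ->
    [/\ measurable (p.2 : set (borel X)),
    (h%:E * (m p.2 + total_variation_open m \1_p.2 [set: X]) <= (C * ci i)%:E)%E &
    {ae m, forall x, Omega x -> \1_p.2 x = ((p.1 < ul i x)%R : nat)%:R :> R}]).
  move=> i; have [ilt|_] := ltnP i n; last first.
    by exists (h / 2, set0); split => //=; lra.
  have : (a i < (ci i)%:E)%E.
    by rewrite -(fineK (a_fin _ ilt)) lte_fin ltrDl.
  by move=> /(level_set_extension (iul i) h0)[t [F [tP mF FP aeF]]]; exists (t, F).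
pose t i := (tF i).1; pose F i : set X := (tF i).2.
have tP i : 0 < t i < h by exact: (tFP i).1.
have mF i : (i < n)%N -> measurable (F i : set (borel X)).
  by move=> ilt; have [] := (tFP i).2 ilt.
have Fb i : (i < n)%N ->
    (h%:E * (m (F i) + total_variation_open m \1_(F i) [set: X]) <= (C * ci i)%:E)%E.
  by move=> ilt; have [] := (tFP i).2 ilt.
have mTV i : (0 <= total_variation_open m \1_(F i) [set: X])%E.
  exact: total_variation_open_ge0.
have sum_Cci : (\sum_(i < n) (C * ci i)%:E <= (C * b)%:E)%E.
  by rewrite sumEFin lee_fin -mulr_sumr ler_pM2l.
have TVfin i : (i < n)%N -> total_variation_open m \1_(F i) [set: X] \is a fin_num.
  move=> ilt; rewrite ge0_fin_numE// ltNge leye_eq; apply/eqP => TVy.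
  have := Fb i ilt; rewrite TVy addey ?gt0_muley ?lte_fin//.
  by rewrite -ltNye (lt_le_trans _ (measure_ge0 _ _)).
have mhF i : (i < n)%N -> measurable_fun [set: borel X] (fun x => h * \1_(F i) x).
  by move=> ilt; apply: measurable_funM => //; exact: measurable_indic (mF _ ilt).
exists (fun x => \sum_(i < n) h * \1_(F i) x); split.
- by apply: measurable_sum => i; exact: mhF.
- move=> x; rewrite sumr_ge0//=; last by move=> i _; rewrite mulr_ge0.
  have -> : 1 = \sum_(i < n) h by rewrite sumr_const card_ord -nh mulr_natl.
  apply: ler_sum => i _.
  by rewrite ler_piMr// indicE; case: (_ \in _).
- under eq_integral do rewrite -sumEFin.
  rewrite ge0_integral_sum//; first last.
  + by move=> i x _; rewrite lee_fin mulr_ge0.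
  + by move=> i; apply/measurable_EFinP; exact: mhF.
  apply: le_trans sum_Cci; apply: lee_sum => i _.
  under eq_integral do rewrite EFinM.
  rewrite ge0_integralZl ?lee_fin//; last first.
    by apply/measurable_EFinP; exact: measurable_indic (mF _ (ltn_ord i)).
  rewrite integral_indic ?setIT//; last exact: mF.
  by apply: le_trans (Fb i (ltn_ord i)); rewrite lee_pmul2l ?lte_fin// leeDl.
- apply: (@approximable_weaken _ _ _ _
    (\sum_(i < n) `|h| * fine (total_variation_open m \1_(F i) [set: X]))).
    rewrite -lee_fin; apply: le_trans sum_Cci; rewrite -sumEFin.
    apply: lee_sum => i _; apply: le_trans (Fb i (ltn_ord i)).
    by rewrite EFinM fineK ?TVfin// ger0_norm// lee_pmul2l ?lte_fin// leeDr.
  apply: (@approximable_sum _ _ m n (fun i x => h * \1_(F i) x)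
    (fun i => `|h| * fine (total_variation_open m \1_(F i) [set: X]))) => // i ilt.
  apply: approximable_scale; first exact: measurable_indic (mF _ ilt).
  apply: approximable_indic => //; first exact: mF.
  by rewrite fineK// TVfin.
have : {ae m, forall x, forall i, (i < n)%N -> Omega x ->
    \1_(F i) x = ((t i < ul i x)%R : nat)%:R :> R}.
  apply: ae_foralln => i; have [ilt|nle] := ltnP i n; last by apply: aeW.
  by have [_ _ aeF] := (tFP i).2 ilt; apply: ae_imply aeF _ => x H _.
move=> /ae_imply; apply => x H Ox.
have /andP[u0 u1] := u01 x.
have -> : u x = \sum_(i < n) layer h i (u x).
  by rewrite sum_layer// nh /clamp max_l// min_l.
rewrite -sumrB.
rewrite (eq_bigr (fun i : 'I_n => h * ((t i < layer h i (u x))%R : nat)%:R - layer h i (u x))).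
  exact: layer_quantization.
by move=> i _; rewrite H.
Qed.

(** The limit of the quantized extensions, obtained from [convex_selection]
    applied to the admissible functions within 1 / (n + 1) of [u] in Omega.
    Since all functions take values in [0, 1], almost everywhere convergence
    gives L^1 convergence on balls, where the measure is finite. *)
Lemma bounded_extension (u : X -> R) (c b : R) :
  (forall x, 0 <= u x <= 1) -> mu.-integrable [set: borel X] (EFin \o u) ->
  (total_variation_open mu u Omega < c%:E)%E ->
  (\int[mu]_(x in Omega) `|u x|%:E + (2 * c)%:E < b%:E)%E ->
  exists w : X -> R, [/\ measurable_fun [set: borel X] w, forall x, 0 <= w x <= 1,
    (\int[m]_x (w x)%:E <= (C * b)%:E)%E, approximable m w (C * b) &
    {ae m, forall x, Omega x -> w x = u x}].
Proof.
move=> u01 iu uc ub.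
pose K (n : nat) (w : borel X -> R) := [/\ measurable_fun [set: borel X] w,
  forall x, 0 <= w x <= 1, (\int[m]_x (w x)%:E <= (C * b)%:E)%E,
  approximable m w (C * b) &
  {ae m, forall x, Omega x -> `|w x - u x| <= n.+1%:R^-1}].
have [] := @convex_selection _ (borel X) R m K (C * b).
- by move=> n w [].
- by move=> n w x [].
- by move=> n w [].
- move=> n w [mw w01 wi wa wu]; split => //; apply: ae_imply wu _ => x H /H xw.
  by apply: (le_trans xw); rewrite lef_pV2 ?posrE// ler_nat.
- move=> n w v [mw w01 wi wa wu] [mv v01 vi va vu]; split.
  + by apply: measurable_funM => //; exact: measurable_funD.
  + by move=> x; have := w01 x; have := v01 x; lra.
  + under eq_integral do rewrite EFinM EFinD.
    rewrite ge0_integralZl//; first last.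
    * by move=> x _; rewrite -EFinD lee_fin addr_ge0//; [have /andP[] := w01 x|have /andP[] := v01 x].
    * by apply: emeasurable_funD; exact/measurable_EFinP.
    rewrite ge0_integralD//; first last.
    * exact/measurable_EFinP.
    * by move=> x _; rewrite lee_fin; have /andP[] := v01 x.
    * exact/measurable_EFinP.
    * by move=> x _; rewrite lee_fin; have /andP[] := w01 x.
    rewrite lee_pdivrMl//; apply: (le_trans (leeD wi vi)).
    by rewrite -EFinD -EFinM lee_fin; lra.
  + apply: (@approximable_weaken _ _ _ _ (`|2^-1| * (C * b + C * b))).
      by rewrite ger0_norm//; lra.
    apply: approximable_scale; first exact: measurable_funD.
    exact: approximable_add.
  + apply: ae_imply2 wu vu _ => x H1 H2 Ox.
    have := H1 Ox; have := H2 Ox; move: (n.+1%:R^-1 : R) => q.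
    by rewrite !ler_norml => /andP[h1 h2] /andP[h3 h4]; lra.
- by move=> n; have [v vP] :=
    quantized_extension n u01 iu uc ub; exists v.
move=> w_ [w [Kw mw w01 wlim]]; exists w.
have mw_ n : measurable_fun [set: borel X] (w_ n) by have [] := Kw n.
have w_01 n x : 0 <= w_ n x <= 1 by have [_ + _ _ _] := Kw n; exact.
have ballcvg r e : 0 < e -> exists n,
    (\int[m]_(x in ball (point : X) r) `|w_ n x - w x|%:E <= e%:E)%E.
  move=> e0.
  have mB := @measurable_ball _ _ (point : X) r.
  have [] := @dominated_convergence _ (borel X) R m (ball (point : X) r) mB
    (fun n => EFin \o w_ n) (EFin \o w) (cst 1%E).
  - by move=> n; apply/measurable_EFinP; exact: measurable_funTS.
  - by apply/measurable_EFinP; exact: measurable_funTS.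
  - apply: ae_imply wlim _ => x wx _.
    by apply: cvg_EFin => //; exact: nearW.
  - apply: (@integrable_bounded _ _ _ _ (cst 1) 1) => //.
      exact: finite_on_bounded_ball.
    by move=> x _; rewrite normr1.
  - apply: aeW => x n _ /=; have /andP[w0 w1] := w_01 n x.
    by rewrite lee_fin ger0_norm.
  move=> _ + _; move=> /ge0_cvg0P H.
  have [|N HN] := H _ e e0; first by move=> n; exact: integral_normr_ge0.
  by exists N; exact: HN.
split => //.
- have -> : (\int[m]_x (w x)%:E = \int[m]_x limn_einf (fun n => (w_ n x)%:E))%E.
    apply: ae_eq_integral => //.
    + exact/measurable_EFinP.
    + by apply: measurable_fun_limn_einf => n; exact/measurable_EFinP.
    apply: ae_imply wlim _ => x wx _.
    have /cvg_limn_einf_sup[-> _] // : (fun n => (w_ n x)%:E) @ \oo --> (w x)%:E.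
    by apply: cvg_EFin => //; exact: nearW.
  apply: (le_trans (fatou m measurableT _ _)).
  + by move=> n; exact/measurable_EFinP.
  + by move=> n x _; rewrite lee_fin; have /andP[] := w_01 n x.
  by apply: limn_einf_le => N; exists N => //; have [] := Kw N.
- apply: approximable_limit => // e e0.
  have [n Hn] := ballcvg e^-1 e e0.
  exists (w_ n); split => //; have [_ _ _ wa _] := Kw n.
  by apply: approximable_weaken wa; rewrite lerDl ltW.
have : {ae m, forall x, forall n, Omega x -> `|w_ n x - u x| <= n.+1%:R^-1}.
  by apply: ae_foralln => n; have [] := Kw n.
move=> wu; apply: ae_imply2 wlim wu _ => x wx wux Ox.
apply/eqP; rewrite -subr_eq0 -normr_le0; apply/ler_addgt0Pl => e e0.
have e20 : 0 < e / 2 by rewrite divr_gt0.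
move/cvgrPdist_le : wx => /(_ _ e20)[N _ HN].
have [M Me] := exists_invn_lt e20.
have h1 := HN (maxn N M) (leq_maxl _ _); have h2 := wux (maxn N M) Ox.
have h3 : (maxn N M).+1%:R^-1 <= M.+1%:R^-1 :> R.
  by rewrite lef_pV2 ?posrE// ler_nat ltnS leq_maxr.
have -> : w x - u x = (w x - w_ (maxn N M) x) + (w_ (maxn N M) x - u x) by lra.
apply: (le_trans (ler_normD _ _)); move: h1 (le_trans h2 (le_trans h3 (ltW Me))) => /=; lra.
Qed.

(** The layers of height 1 are extended separately.  The bounds on the norms of
    their extensions are summable, so the partial sums converge in L^1. *)
Lemma nonneg_extension (u : X -> R) (c b : R) :
  (forall x, 0 <= u x) -> mu.-integrable [set: borel X] (EFin \o u) ->
  (total_variation_open mu u Omega < c%:E)%E ->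
  (\int[mu]_(x in Omega) `|u x|%:E + (4 * c)%:E < b%:E)%E ->
  exists w : X -> R, [/\ measurable_fun [set: borel X] w, forall x, 0 <= w x,
    (\int[m]_x (w x)%:E <= (C * b)%:E)%E, approximable m w (C * b) &
    {ae m, forall x, Omega x -> w x = u x}].
Proof.
move=> u0 iu uc ub.
have mu_ : measurable_fun [set: borel X] u.
  by apply/measurable_EFinP; exact: measurable_int iu.
pose ul i := layer 1 i \o u.
have ul01 i x : 0 <= ul i x <= 1 by exact: layer_bounds.
have iul i : mu.-integrable [set: borel X] (EFin \o ul i).
  apply: integrable_comp_lipschitz => //; first exact: measurable_layer.
    exact: layer_lipschitz.
  exact: layer0.
set I := (\int[mu]_(x in Omega) `|u x|%:E)%E in ub.
have I0 : (0 <= I)%E by exact: integral_normr_ge0.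
have I_fin : I \is a fin_num.
  rewrite ge0_fin_numE//.
  rewrite ltNge leye_eq; apply/eqP => Iy; move: ub.
  by rewrite Iy addye// ltNge leey.
pose ti i := total_variation_open mu (ul i) Omega.
have ti0 i : (0 <= ti i)%E by exact: total_variation_open_ge0.
pose Ii i := (\int[mu]_(x in Omega) `|ul i x|%:E)%E.
have Ii0 i : (0 <= Ii i)%E by exact: integral_normr_ge0.
have sumI N : (\sum_(i < N) Ii i <= I)%E by exact: sum_integral_layer.
have sumt N : (\sum_(i < N) ti i <= (2 * c)%:E)%E.
  exact: sum_total_variation_layer.
have fin_of_sum (a : nat -> \bar R) (l : \bar R) : (forall i, 0 <= a i)%E ->
    l \is a fin_num -> (forall N, \sum_(i < N) a i <= l)%E ->
    forall i, a i \is a fin_num.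
  move=> a0 lf al i; rewrite ge0_fin_numE//; apply: (@le_lt_trans _ _ l); last first.
    by rewrite -(fineK lf) ltry.
  by apply: le_trans (al i.+1); rewrite big_ord_recr/= leeDr// sume_ge0.
have Ii_fin := fin_of_sum Ii I Ii0 I_fin sumI.
have ti_fin := fin_of_sum ti (2 * c)%:E ti0 isT sumt.
(* Layer [i] is given the extra room [e i], once in [ci i] and again in [bi i];
   as [ci i] enters [bi i] twice, the total excess is at most [3 * k]. *)
pose k := (b - (fine I + 4 * c)) / 3.
have k0 : 0 < k by rewrite divr_gt0// subr_gt0 -lte_fin EFinD fineK.
pose e (i : nat) : R := k * 2^-1 ^+ i.+1.
have e0 i : 0 < e i by rewrite mulr_gt0// exprn_gt0.
have sum_e N : \sum_(i < N) e i <= k.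
  suff -> : \sum_(i < N) e i = k - k * 2^-1 ^+ N.
    by rewrite gerBl mulr_ge0// ?exprn_ge0// ltW.
  elim: N => [|N IH]; first by rewrite big_ord0 expr0 mulr1 subrr.
  by rewrite big_ord_recr/= IH /e exprS; lra.
pose ci i := fine (ti i) + e i.
pose bi i := fine (Ii i) + 2 * ci i + e i.
have sum_b N : \sum_(i < N) bi i <= b.
  have h1 : \sum_(i < N) fine (Ii i) <= fine I.
    rewrite -lee_fin -sumEFin fineK//; apply: le_trans (sumI N).
    by apply: lee_sum => i _; rewrite fineK.
  have h2 : \sum_(i < N) fine (ti i) <= 2 * c.
    rewrite -lee_fin -sumEFin; apply: le_trans (sumt N).
    by apply: lee_sum => i _; rewrite fineK.
  rewrite !big_split/= -mulr_sumr big_split/=; have := sum_e N.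
  have : fine I + 4 * c + 3 * k = b by rewrite /k; lra.
  lra.
have /choice[w_ wP] : forall i, exists w : X -> R,
    [/\ measurable_fun [set: borel X] w, forall x, 0 <= w x <= 1,
    (\int[m]_x (w x)%:E <= (C * bi i)%:E)%E, approximable m w (C * bi i) &
    {ae m, forall x, Omega x -> w x = ul i x}].
  move=> i.
  have h1 : (ti i < (ci i)%:E)%E by rewrite -(fineK (ti_fin i)) lte_fin ltrDl.
  have h2 : (Ii i + (2 * ci i)%:E < (bi i)%:E)%E.
    by rewrite -(fineK (Ii_fin i)) -EFinD lte_fin ltrDl.
  exact: (bounded_extension (ul01 i) (iul i) h1 h2).
have mw i : measurable_fun [set: borel X] (w_ i) by have [] := wP i.
have w0 i x : 0 <= w_ i x by have [_ /(_ x)/andP[] ] := wP i.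
pose W (x : borel X) := (\sum_(0 <= i <oo) (w_ i x)%:E)%E.
have W0 x : (0 <= W x)%E by apply: nneseries_ge0 => i _ _; rewrite lee_fin.
have mW : measurable_fun [set: borel X] W.
  apply: ge0_emeasurable_sum => [i x _|i]; first by rewrite lee_fin.
  by move=> _; exact/measurable_EFinP.
have iW : (\int[m]_x W x <= (C * b)%:E)%E.
  rewrite integral_nneseries//; first last.
  - by move=> i x _; rewrite lee_fin.
  - by move=> i; exact/measurable_EFinP.
  apply: lime_le.
    by apply: is_cvg_nneseries => i _ _; apply: integral_ge0 => x _; rewrite lee_fin.
  apply: nearW => N; rewrite big_mkord.
  apply: (@le_trans _ _ (\sum_(i < N) (C * bi i)%:E)%E).
    by apply: lee_sum => i _; have [] := wP i.
  by rewrite sumEFin lee_fin -mulr_sumr ler_pM2l.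
have intW : m.-integrable [set: borel X] W.
  apply/integrableP; split => //; apply: (@le_lt_trans _ _ (C * b)%:E); last exact: ltry.
  apply: le_trans iW; apply: ge0_le_integral => //; first exact: measurableT_comp.
  by move=> x _; rewrite gee0_abs.
pose w x := fine (W x).
have mw' : measurable_fun [set: borel X] w by exact: measurableT_comp.
have aeWfin : {ae m, forall x, W x \is a fin_num}.
  have /(integrable_ae measurableT) := intW; by move=> /ae_imply; apply => x; exact.
pose S n (x : X) := \sum_(j < n) w_ j x.
have mS n : measurable_fun [set: borel X] (S n) by exact: measurable_sum.
have SE n x : (S n x)%:E = (\sum_(0 <= j < n) (w_ j x)%:E)%E.
  by rewrite big_mkord sumEFin.
have SW x : (fun n => (S n x)%:E) @ \oo --> W x.
  under eq_fun do rewrite SE.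
  by apply: is_cvg_nneseries => i _ _; rewrite lee_fin.
have S_le n x : ((S n x)%:E <= W x)%E.
  by rewrite SE; apply: nneseries_lim_ge => i _ _; rewrite lee_fin.
have S0 n x : 0 <= S n x by apply: sumr_ge0.
have Scvg e' : 0 < e' -> exists n, (\int[m]_x `|S n x - w x|%:E <= e'%:E)%E.
  move=> e'0.
  have [] := @dominated_convergence _ (borel X) R m setT measurableT
    (fun n => EFin \o S n) (EFin \o w) W.
  - by move=> n; exact/measurable_EFinP.
  - exact/measurable_EFinP.
  - by apply: ae_imply aeWfin _ => x Wx _; rewrite /= fineK//; exact: SW.
  - exact: intW.
  - by apply: aeW => x n _; rewrite /= ger0_norm.
  move=> _ + _; move=> /ge0_cvg0P H.
  have [|N HN] := H _ e' e'0; first by move=> n; exact: integral_normr_ge0.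
  by exists N; exact: HN.
exists w; split => //.
- by move=> x; rewrite fine_ge0.
- apply: le_trans iW; apply: ge0_le_integral => //.
  + by move=> x _; rewrite lee_fin fine_ge0.
  + exact/measurable_EFinP.
  + move=> x _; rewrite /w; have := W0 x; case: (W x) => [r| |]//= _.
- apply: approximable_limit => // e' e'0; have [n Sn] := Scvg e' e'0.
  exists (S n); split => //.
  + apply: (@approximable_weaken _ _ _ _ (\sum_(i < n) C * bi i)).
      apply: (@le_trans _ _ (C * b)); last by rewrite lerDl ltW.
      by rewrite -mulr_sumr ler_pM2l.
    apply: (@approximable_sum _ _ m n w_ (fun i => C * bi i)) => // i _.
    by have [] := wP i.
  + apply: le_trans Sn; apply: ge0_subset_integral => //.
      exact: measurable_ball.
    exact: measurable_normrB.
have : {ae m, forall x, forall i, Omega x -> w_ i x = ul i x}.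
  by apply: ae_foralln => i; have [] := wP i.
move=> /ae_imply; apply => x wux Ox.
suff Wu : W x = (u x)%:E by rewrite /w Wu.
have SN n : (Num.truncn (u x) < n)%N -> S n x = u x.
  move=> un; rewrite /S (eq_bigr (fun i : 'I_n => layer 1 i (u x))).
    rewrite sum_layer// mulr1 /clamp max_l// min_l//.
    by apply: (le_trans (ltW (truncnS_gt _))); rewrite ler_nat.
  by move=> i _; rewrite wux.
apply: (cvg_unique _ (SW x)); first exact: ereal_hausdorff.
apply: cvg_near_cst; exists (Num.truncn (u x)).+1 => // n /= un.
by rewrite SN.
Qed.

End extension_of_functions.

(** * The two implications *)

Section bv_facts.
Context {R : realType} {X : completeMetricType R}.
Context (m : {measure set (borel X) -> \bar R}).
Implicit Types (u v w : X -> R).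

Let mX : measurable ([set: X] : set (borel X)) := measurableT.

Lemma mrestr_setT_fun : mrestr m mX = m :> (set (borel X) -> \bar R).
Proof. by apply/funext => A; rewrite /mrestr setIT. Qed.

Lemma mrestr_setT : (mrestr m mX : {measure set (borel X) -> \bar R}) = m.
Proof. by apply: eq_measure; exact: mrestr_setT_fun. Qed.

Lemma BV_setT w : BV m mX w <-> m.-integrable [set: borel X] (EFin \o w) /\
  (total_variation_open m w [set: X] < +oo)%E.
Proof.
rewrite /BV /total_variation_in /= total_variation_openE; last exact: openT.
by rewrite mrestr_setT mrestr_setT_fun.
Qed.

Lemma BVnorm_setT w : BVnorm m mX w =
  (\int[m]_x `|w x|%:E + total_variation_open m w [set: X])%E.
Proof.
rewrite /BVnorm /total_variation_in Lnorm1 total_variation_openE; last exact: openT.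
by rewrite mrestr_setT.
Qed.

Context (Omega : set X) (oOmega : open Omega).
Let mO := open_borel oOmega.
Let mu : {measure set (borel X) -> \bar R} := mrestr m mO.

Lemma BV_open u : BV m mO u <-> mu.-integrable [set: borel X] (EFin \o u) /\
  (total_variation_open mu u Omega < +oo)%E.
Proof. by rewrite /BV /total_variation_in /= total_variation_openE. Qed.

Lemma BVnorm_open u : BVnorm m mO u =
  (\int[mu]_x `|u x|%:E + total_variation_open mu u Omega)%E.
Proof. by rewrite /BVnorm /total_variation_in Lnorm1 total_variation_openE. Qed.

Lemma ae_mrestr (P : X -> Prop) : {ae mu, forall x, P x} <->
  {ae m, forall x, Omega x -> P x}.
Proof.
split=> -[N [mN N0 PN]].
  exists (N `&` Omega); split => //; first exact: measurableI.
  move=> x /= nP; have [Ox nPx] : Omega x /\ ~ P x by apply/not_implyP.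
  by split => //; apply: PN.
exists (N `|` ~` Omega); split.
- by apply: measurableU => //; exact: measurableC.
- rewrite /mu /= /mrestr setIUl setICl setU0.
  apply/eqP; rewrite eq_le measure_ge0 andbT -N0.
  by apply: le_measure; rewrite ?inE//; exact: measurableI.
move=> x /= nPx; have [Ox|] := pselect (Omega x); last by right.
by left; apply: PN => /= /(_ Ox).
Qed.

Lemma total_variation_open_ae_le u v :
  mu.-integrable [set: borel X] (EFin \o u) ->
  mu.-integrable [set: borel X] (EFin \o v) ->
  {ae mu, forall x, u x = v x} ->
  (total_variation_open mu v Omega <= total_variation_open mu u Omega)%E.
Proof.
move=> iu iv uv; apply: le_ereal_inf_tmp => _ [f_ [lipf cvgf] <-].
apply: ereal_inf_lbound; exists f_ => //; split => // x.
have [U [oU Ux intf _ cvgU]] := cvgf x.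
have mUO : measurable (U `&` Omega : set (borel X)).
  by apply: open_borel; exact: openI.
exists U; split => //; first exact: integrableS iv.
have -> // : (fun n => \int[mu]_(y in U `&` Omega) `|f_ n y - v y|%:E)%E =
  (fun n => \int[mu]_(y in U `&` Omega) `|f_ n y - u y|%:E)%E.
apply/funext => n.
have mf g : mu.-integrable [set: borel X] (EFin \o g) ->
    measurable_fun (U `&` Omega : set (borel X)) (fun y => `|f_ n y - g y|%:E).
  move=> ig; apply/measurable_EFinP; apply: measurableT_comp => //.
  apply: measurable_funB.
    by apply/measurable_EFinP; exact: measurable_int (intf n).
  by apply: measurable_funTS; apply/measurable_EFinP; exact: measurable_int ig.
apply: ae_eq_integral => //; [exact: mf|exact: mf|].
by apply: ae_imply uv _ => y uvy _; rewrite uvy.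
Qed.

(** Thanks to this, the set of admissible extensions of [u] depends only on the
    class of [u]. *)
Lemma BVnorm_ae u v : BV m mO u -> BV m mO v -> u = v %[ae m in Omega] ->
  BVnorm m mO u = BVnorm m mO v.
Proof.
move=> /BV_open[iu _] /BV_open[iv _] /ae_mrestr uv.
have vu : {ae mu, forall x, v x = u x} by apply: ae_imply uv _.
rewrite !BVnorm_open; congr (_ + _)%E.
  apply: ae_eq_integral => //.
  - by apply/measurable_EFinP; apply: measurableT_comp => //;
      apply/measurable_EFinP; exact: measurable_int iu.
  - by apply/measurable_EFinP; apply: measurableT_comp => //;
      apply/measurable_EFinP; exact: measurable_int iv.
  - by apply: ae_imply uv _ => x uvx _; rewrite uvx.
by apply/eqP; rewrite eq_le !total_variation_open_ae_le.
Qed.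

End bv_facts.

Section equivalence.
Context {R : realType} {X : completeMetricType R}.
Context (m : {measure set (borel X) -> \bar R}) (Omega : set X).
Context (sepX : separable X) (finm : finite_on_bounded m) (oOmega : open Omega).

Let mO := open_borel oOmega.
Let mX : measurable ([set: X] : set (borel X)) := measurableT.
Let mu : {measure set (borel X) -> \bar R} := mrestr m mO.

Lemma total_variation_open0 :
  (total_variation_open m (fun=> 0%R) [set: X] <= 0)%E.
Proof.
apply: approximable_total_variation => //; first exact: integrable0.
exact: approximable0.
Qed.

(** The positive and negative parts are extended by [nonneg_extension], whose
    strict inequalities are met by a multiple of the norm of [u] when this norm
    is positive; otherwise [u] vanishes
    almost everywhere in Omega and is extended by zero. *)
Lemma exists_BV_extension (C : R) u : 0 < C ->
  (forall E : set (borel X),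
    measurable E -> E `<=` Omega -> (perimeter_in m mO E < +oo)%E ->
    exists F : set (borel X), [/\ measurable F,
      (m F + perimeter m F [set: X] <= C%:E * (m E + perimeter_in m mO E))%E &
      m (E `+` (F `&` Omega)) = 0%E]) ->
  BV m mO u -> exists w, [/\ BV m mX w,
    (BVnorm m mX w <= (40 * C)%:E * BVnorm m mO u)%E &
    w = u %[ae m in Omega]].
Proof.
move=> C0 extP /BV_open[iu Tfin].
have mu_ : measurable_fun [set: borel X] u.
  by apply/measurable_EFinP; exact: measurable_int iu.
rewrite BVnorm_open -/mO -/mu; set I := (\int[mu]_x `|u x|%:E)%E.
set T := total_variation_open mu u Omega in Tfin *.
have I0 : (0 <= I)%E by exact: integral_normr_ge0.
have T0 : (0 <= T)%E by exact: total_variation_open_ge0.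
have I_fin : I \is a fin_num.
  rewrite ge0_fin_numE//; have /integrableP[_] := iu; exact: le_lt_trans.
have T_fin : T \is a fin_num by rewrite ge0_fin_numE.
pose n := fine I + fine T.
have IT : (I + T)%E = n%:E by rewrite /n EFinD !fineK.
have n0 : 0 <= n by rewrite addr_ge0 ?fine_ge0.
rewrite IT.
have [nz|npos] := eqVneq n 0.
  have TV0 := total_variation_open0; exists (fun=> 0).
  split.
  - apply/BV_setT; split; first exact: integrable0.
    by apply: le_lt_trans TV0 _; exact: ltry.
  - rewrite BVnorm_setT nz mule0 integral0_eq ?add0e// => x _.
    by rewrite normr0.
  apply/ae_mrestr; rewrite -/mO -/mu.
  have Iz : I = 0%E.
    rewrite -(fineK I_fin); congr EFin.
    have := fine_ge0 I0; have := fine_ge0 T0; move: nz; rewrite /n; lra.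
  have mEu : measurable_fun [set: borel X] (EFin \o u) by exact/measurable_EFinP.
  have := (ae_eq_integral_abs mu measurableT mEu).1 Iz.
  by move=> /ae_imply; apply => x /(_ Logic.I) [].
have {n0 npos} n0 : 0 < n by rewrite lt_neqAle eq_sym npos.
(* [I + 4 * c <= 8 * n < b].  Each part then has mass and variation at most
   [C * b], which makes [40 * C * n] for the norm of the difference. *)
pose c := fine T + n; pose b := 10 * n.
have half (phi : R -> R) : (forall s, 0 <= phi s) ->
    measurable_fun [set: R] phi -> (forall s t, `|phi s - phi t| <= 1 * `|s - t|) ->
    phi 0 = 0 -> exists w : X -> R, [/\ measurable_fun [set: borel X] w,
    forall x, 0 <= w x,
    (\int[m]_x (w x)%:E <= (C * b)%:E)%E, approximable m w (C * b) &
    {ae m, forall x, Omega x -> w x = phi (u x)}].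
  move=> phi0 mphi lip phi00.
  have phi_le s : `|phi s| <= `|s|.
    by have := lip s 0; rewrite phi00 !subr0 mul1r.
  have mpu : measurable_fun [set: borel X] (phi \o u) by exact: measurableT_comp.
  apply: (nonneg_extension sepX finm C0 extP (u := phi \o u) (c := c)).
  - by move=> x; exact: phi0.
  - exact: integrable_comp_lipschitz.
  - apply: (@le_lt_trans _ _ T); first exact: total_variation_open_comp.
    by rewrite -(fineK T_fin) lte_fin ltrDl.
  - apply: (@le_lt_trans _ _ (I + (4 * c)%:E)%E).
      rewrite leeD2r//; apply: (@le_trans _ _ (\int[mu]_(x in Omega) `|u x|%:E)%E).
        apply: ge0_le_integral => //.
        + apply/measurable_EFinP; apply: measurable_funTS; exact: measurableT_comp.
        + apply/measurable_EFinP; apply: measurable_funTS; exact: measurableT_comp.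
        + by move=> x _; rewrite lee_fin; exact: phi_le.
      apply: ge0_subset_integral => //.
      by apply/measurable_EFinP; exact: measurableT_comp.
    rewrite -(fineK I_fin) -EFinD lte_fin /c /b.
    have := fine_ge0 I0; have := fine_ge0 T0; move: n0; rewrite /n; lra.
have [||||wp [mwp wp0 iwp awp ewp]] := half (fun s => Num.max s 0).
- by move=> s; rewrite le_max lexx orbT.
- exact: measurable_maxr.
- move=> s t; rewrite mul1r; have := ler_norm (s - t); have := ler_norm (t - s).
  rewrite (distrC t s) ler_norml; case: (leP s 0); case: (leP t 0); lra.
- by rewrite maxxx.
have [||||wn [mwn wn0 iwn awn ewn]] := half (fun s => Num.max (- s) 0).
- by move=> s; rewrite le_max lexx orbT.
- by apply: measurable_maxr.
- move=> s t; rewrite mul1r; have := ler_norm (s - t); have := ler_norm (t - s).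
  rewrite (distrC t s) ler_norml; case: (leP (- s) 0); case: (leP (- t) 0); lra.
- by rewrite oppr0 maxxx.
pose w x := wp x - wn x.
have mw : measurable_fun [set: borel X] w by exact: measurable_funB.
have iw : (\int[m]_x `|w x|%:E <= (20 * C * n)%:E)%E.
  apply: (@le_trans _ _ (\int[m]_x ((wp x)%:E + (wn x)%:E))%E).
    apply: ge0_le_integral => //.
    + by apply/measurable_EFinP; exact: measurableT_comp.
    + by apply: emeasurable_funD; exact/measurable_EFinP.
    + move=> x _; rewrite -EFinD lee_fin /w; have := wp0 x; have := wn0 x.
      by rewrite ler_norml; lra.
  rewrite ge0_integralD//; try exact/measurable_EFinP;
    try by move=> x _; rewrite lee_fin.
  apply: (le_trans (leeD iwp iwn)); rewrite -EFinD lee_fin /b; lra.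
have intw : m.-integrable [set: borel X] (EFin \o w).
  apply/integrableP; split; first exact/measurable_EFinP.
  by apply: le_lt_trans iw _; exact: ltry.
have TVw : (total_variation_open m w [set: X] <= (20 * C * n)%:E)%E.
  apply: approximable_total_variation => //.
  have -> : w = (fun x => wp x + (-1) * wn x).
    by apply/funext => x; rewrite /w mulN1r.
  apply: (@approximable_weaken _ _ _ _ (C * b + `|-1| * (C * b))).
    by rewrite normrN1 /b; lra.
  apply: approximable_add => //; first exact: measurable_funM.
  exact: approximable_scale.
exists w; split.
- apply/(BV_setT m w); split; first exact: intw.
  exact: le_lt_trans TVw (ltry _).
- rewrite BVnorm_setT; apply: (le_trans (leeD iw TVw)).
  by rewrite -EFinD -EFinM lee_fin; lra.
- apply: ae_imply2 ewp ewn _ => x hp hn Ox; rewrite /w hp// hn//.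
  by case: (leP (u x) 0); case: (leP (- u x) 0); lra.
Qed.

(** Choosing from the set of all admissible extensions of [u] makes the choice
    compatible with almost everywhere equality. *)
Lemma perimeter_extension_BV_extension :
  perimeter_extension_property m mO -> BV_extension_set m mO.
Proof.
move=> [C C0 extP].
pose good u : set (X -> R) := [set w | [/\ BV m mX w,
    (BVnorm m mX w <= (40 * C)%:E * BVnorm m mO u)%E &
    w = u %[ae m in Omega]]].
exists (40 * C), (fun u => xget (fun=> 0) (good u)); split.
- by rewrite mulr_gt0.
- move=> u v BVu BVv uv.
  have -> : good u = good v; last by apply: aeW.
  rewrite /good (BVnorm_ae BVu BVv uv); apply/funext => w; apply/propext.
  split => -[BVw wn wu]; split => //.
    by apply: ae_imply2 wu uv _ => x h1 h2 Ox; rewrite h1// h2.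
  by apply: ae_imply2 wu uv _ => x h1 h2 Ox; rewrite h1// h2.
move=> u BVu; have [w gw] := exists_BV_extension C0 extP BVu.
exact: (xgetPex (fun=> 0) (ex_intro (good u) w gw)).
Qed.

(** For 0 < t < 1 the set where the extension of the indicator of [A] exceeds
    [t] coincides with [A] almost everywhere in Omega.  The constant is doubled
    to make room for the strict inequality in [coarea_level]. *)
Lemma BV_extension_perimeter_extension :
  BV_extension_set m mO -> perimeter_extension_property m mO.
Proof.
move=> [C [E [C0 _ extE]]]; exists (2 * C); first by rewrite mulr_gt0.
move=> A mA AO; set P := perimeter_in m mO A => Pfin.
have TVA : total_variation_open mu \1_A Omega = P.
  by rewrite /P /perimeter_in /total_variation_in total_variation_openE.
have P0 : (0 <= P)%E by rewrite -TVA; exact: total_variation_open_ge0.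
have [my|mfin] := eqVneq (m A) +oo%E.
  exists A; split => //.
    have PNy : P != -oo%E by rewrite -ltNye; exact: lt_le_trans P0.
    have C20 : (0 < (2 * C)%:E)%E by rewrite lte_fin mulr_gt0.
    have -> : ((2 * C)%:E * (m A + P) = +oo)%E by rewrite my (addye PNy) gt0_muley.
    exact: leey.
  by rewrite (setIidl AO) setYK measure0.
have m_fin : m A \is a fin_num by rewrite ge0_fin_numE// ltey.
have P_fin : P \is a fin_num by rewrite ge0_fin_numE.
have muA : mu A = m A by rewrite /mu /= /mrestr; congr (m _); exact/setIidPl.
have m1 : measurable_fun [set: borel X] (\1_A : X -> R) by exact: measurable_indic.
have i1 : (\int[mu]_x `|\1_A x : R|%:E = m A)%E.
  under eq_integral do rewrite ger0_norm//.
  by rewrite integral_indic ?setIT.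
have BV1 : BV m mO \1_A.
  apply/BV_open; split; last by rewrite -/mO -/mu TVA.
  apply/integrableP; split; first exact/measurable_EFinP.
  by rewrite -/mO -/mu /= i1 ltey.
pose n := fine (m A) + fine P.
have nE : (m A + P)%E = n%:E by rewrite /n EFinD !fineK.
have n0 : 0 <= n by rewrite addr_ge0 ?fine_ge0.
have norm1 : BVnorm m mO \1_A = n%:E by rewrite BVnorm_open -/mO -/mu i1 TVA.
have [nz|npos] := eqVneq n 0.
  exists set0; rewrite nE nz mule0; split => //.
    rewrite measure0 add0e /perimeter total_variation_openE; last exact: openT.
    have -> : \1_set0 = (fun=> 0) :> (X -> R).
      by apply/funext => x; rewrite indicE in_set0.
    exact: total_variation_open0.
  rewrite set0I setY_def setD0 set0D setU0 -(fineK m_fin); congr EFin.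
  have := fine_ge0 P0; have := fine_ge0 (measure_ge0 m A); move: nz; rewrite /n; lra.
have {n0 npos} n0 : 0 < n by rewrite lt_neqAle eq_sym npos.
have [/BV_setT[iE _] nEle aeE] := extE _ BV1.
rewrite BVnorm_setT norm1 in nEle.
have [|t [t0 t1 tP]] := @coarea_level _ _ m [set: X] (E \1_A) 1 (2 * C * n)
  finm openT iE ltr01.
  apply: (le_lt_trans nEle); rewrite -EFinM lte_fin.
  by rewrite -mulrA mulr_natl mulr2n ltrDl mulr_gt0.
rewrite !setTI mul1e in tP.
have mE : measurable_fun [set: borel X] (E \1_A).
  by apply/measurable_EFinP; exact: measurable_int iE.
exists [set x | t < E \1_A x]; split.
- exact: measurable_superlevel.
- rewrite nE -EFinM /perimeter total_variation_openE//; exact: openT.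
have mF : measurable ([set x | t < E \1_A x] : set (borel X)).
  exact: measurable_superlevel.
have [N [mN N0 HN]] := aeE.
apply/eqP; rewrite eq_le measure_ge0 andbT -N0; apply: le_measure.
- rewrite inE; apply: measurableU; apply: measurableD => //; exact: measurableI.
- by rewrite inE.
move=> x Hx; apply: HN => /= H; case: Hx => -[].
  move=> Ax; apply; split; last exact: AO.
  by rewrite /= (H (AO _ Ax)) indicE mem_set.
by move=> [/= tx Ox]; move: tx; rewrite (H Ox) indicE => tx nA; move: tx; rewrite memNset//= ltNge (ltW t0).
Qed.

End equivalence.


Unset Implicit Arguments.

Theorem theorem1p3 (R : realType) (X : completeMetricType R)
  (m : {measure set (borel X) -> \bar R}) (Omega : set X)
  (sepX : separable X) (finm : finite_on_bounded m) (oOmega : open Omega) :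
  BV_extension_set m (open_borel oOmega) <->
  perimeter_extension_property m (open_borel oOmega).
Proof.
split.
  exact: BV_extension_perimeter_extension.
exact: perimeter_extension_BV_extension.
Qed.
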